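(* Let $\Phi$ satisfy condition $C$ with doubling constant $c_0$, let $(w,v)$ be weights satisfying condition $F$ with exponent $\beta$, and let $s,t$ be such that $0<s\le1/2$, $1/2<t<1-s$, and $c_0\big(\frac{s}{1-t}\big)^\beta<1$. Let $T$ be a linear operator and $M_T$ a mapping that satisfy the splitting property with parameter $s$ (see context). Then for any cube $Q_0$ and any $f$ in the class $\mathcal{S}$ of the splitting property, $$\int_{Q_0}\Phi(|Tf(x)-m_{Tf}(t,Q_0)|)\,w(x)\,dx\le c\int_{Q_0}\Phi(M_Tf(x))\,v(x)\,dx,$$ where $c$ is independent of $Q_0$ and $f$. Furthermore, if $\lim_{Q_0\to\mathbb{R}^n}m_{Tf}(t,Q_0)=0$, $$\int_{\mathbb{R}^n}\Phi(|Tf(x)|)\,w(x)\,dx\le c\int_{\mathbb{R}^n}\Phi(M_Tf(x))\,v(x)\,dx.$$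
   Context: All cubes have sides parallel to the axes. A weight is a nonnegative locally integrable function on $\mathbb{R}^n$. A continuous function $\Phi$ satisfies condition $C$ with doubling constant $c_0$ if it is increasing on $[0,\infty)$, $\Phi(0)=0$, and $\Phi(2\tau)\le c_0\Phi(\tau)$ for all $\tau>0$. Condition $F$: $(w,v)$ satisfy condition $F$ if there exist positive constants $c_1,\alpha,\beta$ with $0<\alpha<1$ such that for any cube $Q$ and measurable $E\subset Q$ with $|E|\le\alpha|Q|$, $\int_Ew\,dx\le c_1(|E|/|Q|)^\beta\int_{Q\setminus E}v\,dx$. Splitting property with parameter $s$: $M_T$ assigns to $f$ a nonnegative function $M_Tf$ on $\mathbb{R}^n$, and there are constants $c_1',c_2'>0$ and a dense class $\mathcal{S}$ of functions of the domain of $T$ such that for every cube $Q_0$ and any cube $Q\subset Q_0$ there exists $x_Q\in Q$ such that every $f\in\mathcal{S}$ can be written as $f=f_1+f_2$ (the decomposition may depend on $Q$) with $|\{z\in Q:|Tf_1(z)|>c_1'\inf_{y\in Q}M_Tf(y)\}|<s|Q|$ and $\|Tf_2-Tf_2(x_Q)\|_{L^\infty(Q)}\le c_2'\inf_{y\in Q}M_Tf(y)$. The (maximal) median is $m_g(t,Q)=\sup\{M:|\{y\in Q:g(y)<M\}|\le t|Q|\}$. The notation $Q_0\to\mathbb{R}^n$ means that the cubes expand to fill $\mathbb{R}^n$. *)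

(* Defs.v *)
From HB Require Import structures.
From mathcomp Require Import all_boot all_order all_algebra.
From mathcomp Require Import all_classical all_reals all_analysis.
From mathcomp Require Import lra.

Set Implicit Arguments.
Unset Strict Implicit.
Unset Printing Implicit Defensive.

Import Order.TTheory GRing.Theory Num.Theory.
Import numFieldNormedType.Exports.

Local Open Scope classical_set_scope.
Local Open Scope ring_scope.

Section Rn.
Variable R : realType.

Definition cons_pair n (p : R * n.-tuple R) :
  n.+1.-tuple R := [the n.+1.-tuple _ of p.1 :: p.2].

Lemma measurable_cons_pair n : measurable_fun setT (@cons_pair n).
Proof. exact: measurable_cons. Qed.

Lemma behead_cons_pair n p : behead_tuple (@cons_pair n p) = p.2.
Proof. exact/val_inj. Qed.

(* Identify R^(n+1) with R x R^n. *)
Definition borel_lebesgueS n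
    (m : {sigma_finite_measure set (n.-tuple R) -> \bar R})
    : set (n.+1.-tuple R) -> \bar R :=
  pushforward (lebesgue_measure \x m)%E (@cons_pair n).

Section borel_lebesgueS_measure.
Variables (n : nat)
  (m : {sigma_finite_measure set (n.-tuple R) -> \bar R}).

Let bl0 : borel_lebesgueS m set0 = 0%E.
Proof. by rewrite /borel_lebesgueS /pushforward preimage_set0 measure0. Qed.

Let bl_ge0 A : (0 <= borel_lebesgueS m A)%E.
Proof. by rewrite /borel_lebesgueS /pushforward; exact: measure_ge0. Qed.

Let bl_sigma_additive : semi_sigma_additive (borel_lebesgueS m).
Proof.
pose P := measure_function_pushforward__canonical__measure_function_Measure
  (lebesgue_measure \x m)%E (@measurable_cons_pair n).
exact: (@measure_semi_sigma_additive _ _ _ P).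
Qed.

HB.instance Definition _ := isMeasure.Build _ _ _
  (borel_lebesgueS m) bl0 bl_ge0 bl_sigma_additive.

Let bl_sigma_finite : sigma_finite setT (borel_lebesgueS m).
Proof.
have /sigma_finiteP[F [TF ndF Foo]] := sigma_finiteT (@lebesgue_measure R).
have /sigma_finiteP[G [TG ndG Goo]] := sigma_finiteT m.
exists (fun k => [set x | F k (thead x) /\ G k (behead_tuple x)]).
  rewrite predeqE => x; split=> // _.
  have [i _ Fi] : (\bigcup_i F i) (thead x) by rewrite -TF.
  have [j _ Gj] : (\bigcup_i G i) (behead_tuple x) by rewrite -TG.
  exists (maxn i j) => //; split.
  - by move: (thead x) Fi; exact/subsetPset/ndF/leq_maxl.
  - by move: (behead_tuple x) Gj; exact/subsetPset/ndG/leq_maxr.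
move=> k; have [mF Fk] := Foo k; have [mG Gk] := Goo k; split.
  apply: measurableI; rewrite -[X in measurable X]setTI.
  - exact: measurable_tnth.
  - exact: measurable_behead.
rewrite /borel_lebesgueS /pushforward (_ : _ @^-1` _ = F k `*` G k).
  rewrite product_measure1E// lte_mul_pinfty// ge0_fin_numE//.
by apply/seteqP; split=> p /= [Fp Gp]; split=> //; move: Gp; rewrite behead_cons_pair.
Qed.

HB.instance Definition _ := Measure_isSigmaFinite.Build _ _ _
  (borel_lebesgueS m) bl_sigma_finite.

End borel_lebesgueS_measure.

Fixpoint borel_lebesgue n :
    {sigma_finite_measure set (n.-tuple R) -> \bar R} :=
  if n is n'.+1 then borel_lebesgueS (borel_lebesgue n')
  else \d_([tuple] : 0.-tuple R).

(* R^n with the sigma-algebra of Lebesgue measurable (not only Borel) sets. *)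
Definition Rn n : measurableType _ := caratheodory_type (borel_lebesgue n)^*%mu.

Definition leb n : {measure set (Rn n) -> \bar R} :=
  @completed_measure_extension _ _ _ (borel_lebesgue n).

Definition Rn_coord n (x : Rn n) (i : 'I_n) : R := tnth x i.

Definition cube n (a : Rn n) (l : R) : set (Rn n) :=
  [set x | forall i, Rn_coord a i <= Rn_coord x i <= Rn_coord a i + l].

Definition is_cube n (Q : set (Rn n)) :=
  exists (a : Rn n) (l : R), 0 < l /\ Q = cube a l.

Lemma borel_lebesgue_box n (a b : 'I_n -> R) : (forall i, a i <= b i) ->
  let B := [set x : n.-tuple R | forall i, a i <= tnth x i <= b i] in
  measurable B /\ borel_lebesgue n B = (\prod_i (b i - a i))%:E.
Proof.
elim: n a b => [|n IH] a b ab B.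
  split.
    rewrite (_ : B = setT); first exact: measurableT.
    by apply/seteqP; split=> // x _ [].
  by rewrite big_ord0 /= /dirac indicE mem_set //; case.
have [mB bB] := IH (a \o lift ord0) (b \o lift ord0) (fun i => ab _).
split.
  rewrite (_ : B = \bigcap_(i in setT) (fun x => tnth x i) @^-1` `[a i, b i]).
    apply: (@fin_bigcap_measurable _ (n.+1.-tuple R)).
      exact: finite_finset.
    move=> i _; rewrite -[X in measurable X]setTI.
    exact: (@measurable_tnth _ R n.+1 i measurableT `[a i, b i]%classic
      (measurable_itv _)).
  apply/seteqP; split => x /= H i; first by move=> _ /=; rewrite in_itv /=; exact: H.
  by have := H i I; rewrite /= in_itv.
rewrite /= /borel_lebesgueS /pushforward.
rewrite (_ : _ @^-1` _ = `[a ord0, b ord0]%classic `*`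
    [set x : n.-tuple R | forall i, a (lift ord0 i) <= tnth x i <= b (lift ord0 i)]).
  rewrite product_measure1E; [|exact: (measurable_itv `[a ord0, b ord0])|exact: mB].
  rewrite bB big_ord_recl EFinM; congr (_ * _)%E.
  have := lebesgue_measure_itv `[a ord0, b ord0]; rewrite /= => ->.
  by rewrite lte_fin; case: ltgtP (ab ord0) => // ->; rewrite subrr.
apply/seteqP; split => -[x y] /=.
  move=> H; split; first by have := H ord0; rewrite in_itv /=.
  by move=> i; have := H (lift ord0 i); rewrite /cons_pair tnthS.
move=> [H1 H2] i; case: (unliftP ord0 i) => [j ->|->].
  by rewrite tnthS; exact: H2.
by rewrite in_itv /= in H1.
Qed.

Lemma leb_cube n (a : Rn n) l : 0 <= l ->
  measurable (cube a l) /\ leb n (cube a l) = (l ^+ n)%:E.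
Proof.
move=> l0.
have [|m b] := @borel_lebesgue_box n (Rn_coord a) (fun i => Rn_coord a i + l).
  by move=> i; rewrite lerDl.
split.
  by apply: sub_caratheodory; apply: sub_sigma_algebra; exact: m.
etransitivity; first exact: (measurable_mu_extE (borel_lebesgue n) m).
rewrite [LHS]b; congr EFin.
under eq_bigr do rewrite addrC addKr.
by rewrite prodr_const card_ord.
Qed.

(* The library's [locally_integrable] is for functions on the real line only;
   compactness is that of the usual topology, read off row vectors. *)
Definition compact_Rn n (K : set (Rn n)) :=
  compact [set (\row_i Rn_coord x i : 'rV[R]_n) | x in K].

Definition weight n (w : Rn n -> R) :=
  [/\ measurable_fun setT w, (forall x, 0 <= w x) &
      forall K, compact_Rn K -> (\int[leb n]_(x in K) (w x)%:E < +oo)%E].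

(* "Increasing" is read in the wide sense. *)
Definition condition_C (Phi : R -> R) (c0 : R) :=
  [/\ {within `[0, +oo[, continuous Phi},
      {in `[0, +oo[ &, {homo Phi : x y / x <= y}},
      Phi 0 = 0 &
      forall tau, 0 < tau -> Phi (2 * tau) <= c0 * Phi tau].

Definition condition_F n (w v : Rn n -> R) (beta : R) :=
  0 < beta /\ exists c1 alpha : R, [/\ 0 < c1, 0 < alpha < 1 &
    forall Q E : set (Rn n), is_cube Q -> measurable E -> E `<=` Q ->
      (leb n E <= alpha%:E * leb n Q)%E ->
      (\int[leb n]_(x in E) (w x)%:E <=
       (c1 * (fine (leb n E) / fine (leb n Q)) `^ beta)%:E *
       \int[leb n]_(x in Q `\` E) (v x)%:E)%E].

Definition median n (g : Rn n -> R) (t : R) (Q : set (Rn n)) : R :=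
  sup [set M | (leb n [set y | Q y /\ (g y < M)%R] <= t%:E * leb n Q)%E].

Definition Linfty_norm n (Q : set (Rn n)) (g : Rn n -> R) : \bar R :=
  'N[leb n]_+oo[(EFin \o g) \_ Q].

(* The domain of T is a topological vector space X. *)
Definition splitting_property n (X : topologicalLmodType R)
    (T MT : X -> Rn n -> R) (s : R) (S : set X) :=
  dense S /\ exists c1 c2 : R, [/\ 0 < c1, 0 < c2 &
    forall Q0 Q : set (Rn n), is_cube Q0 -> is_cube Q -> Q `<=` Q0 ->
      exists2 xQ : Rn n, Q xQ & forall f, S f ->
        let m := inf [set MT f y | y in Q] in
        exists f1 f2 : X, [/\ f = f1 + f2,
          (leb n [set z | Q z /\ (c1 * m < `|T f1 z|)%R] < s%:E * leb n Q)%E &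
          (Linfty_norm Q (fun z => T f2 z - T f2 xQ)%R <= (c2 * m)%:E)%E]].

(* Q0 -> R^n: the cubes directed by inclusion. *)
Definition cubes_to_Rn n : set_system (set (Rn n)) :=
  [set P | exists2 Q1, is_cube Q1 &
             forall Q0, is_cube Q0 -> Q1 `<=` Q0 -> P Q0].

Lemma cube_directed n (Q1 Q2 : set (Rn n)) : is_cube Q1 -> is_cube Q2 ->
  exists2 Q, is_cube Q & Q1 `|` Q2 `<=` Q.
Proof.
move=> [a [k [k0 ->]]] [b [l [l0 ->]]].
pose M := k + l + \sum_(i < n) (`|Rn_coord a i| + `|Rn_coord b i|).
have M0 : 0 < M by rewrite ltr_wpDr ?addr_gt0 ?sumr_ge0.
have ab i : k + l + (`|Rn_coord a i| + `|Rn_coord b i|) <= M.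
  by rewrite lerD2l (bigD1 i) //= lerDl sumr_ge0.
have cE i : Rn_coord ([tuple - M | i < n] : Rn n) i = - M.
  by rewrite /Rn_coord tnth_mktuple.
exists (cube ([tuple - M | i < n] : Rn n) (M + M)).
  by exists [tuple - M | i < n], (M + M); split => //; exact: addr_gt0.
move=> x xQ i; rewrite cE addKr; have := ab i.
have := ler_norm (Rn_coord a i); have := ler_norm (Rn_coord b i).
have := ler_norm (- Rn_coord a i); have := ler_norm (- Rn_coord b i).
rewrite !normrN; case: xQ => /(_ i) /andP[]; lra.
Qed.

Global Instance cubes_to_Rn_filter n : ProperFilter (@cubes_to_Rn n).
Proof.
apply: Build_ProperFilter_ex => [P [Q cQ QP]|]; first by exists Q; exact: QP.
split.
- exists (cube (point : Rn n) 1) => //; exists point, 1; split=> //.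
- move=> P1 P2 [Q1 c1 QP1] [Q2 c2 QP2].
  have [Q cQ Q12] := cube_directed c1 c2; exists Q => // Q0 cQ0 QQ0.
  split; [apply: QP1|apply: QP2] => // x Qx; apply/QQ0/Q12; by [left|right].
- move=> P1 P2 P12 [Q cQ QP]; exists Q => // Q0 cQ0 QQ0; exact/P12/QP.
Qed.

End Rn.

Arguments cubes_to_Rn : clear implicits.

(* Main.v *)
Require Import Defs.
From HB Require Import structures.
From mathcomp Require Import all_boot all_order all_algebra.
From mathcomp Require Import all_classical all_reals all_analysis.
From mathcomp Require Import measurable_realfun ess_sup_inf.
From mathcomp Require Import ring lra zify.

Set Implicit Arguments.
Unset Strict Implicit.
Unset Printing Implicit Defensive.

Import Order.TTheory GRing.Theory Num.Theory.
Import numFieldNormedType.Exports.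
Import HBNNSimple.

Local Open Scope classical_set_scope.
Local Open Scope ring_scope.

(** Fix a cube [Q0] and [f] in the class. Write [m Q] for the median of [T f] on [Q]
    and [A Q] for the infimum of [MT f] on [Q].

    Oscillation. The splitting property says that [T f] is within a multiple of [A Q]
    of a constant off a subset of [Q] of measure less than [s |Q|]. Since [s < 1 - t],
    the median [m Q] is as close to that constant ([median_close]), so the set where
    [T f] is far from [m Q] also has measure less than [s |Q|].

    Stopping cubes. Inside [Q], select the maximal dyadic subcubes on which that far
    set has density at least [1 - t]. Their total measure is at most [lam |Q|] with
    [lam = s / (1 - t) < 1] ([leb_layer1]), they cover the far set up to a null set
    ([leb_far_uncovered]), and the median on a stopping cube [P] differs from [m Q] by
    a multiple of [A Q + A P] ([med_stop_child]). Iterating from [Q0], almost every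
    point [x] lies in finitely many generations of stopping cubes, and
    [|T f x - m Q0|] is at most a multiple of the sum of [A Q] over the stopping cubes
    [Q] containing [x] ([stopping_representation]).

    Summation. The union [layer Q j] of the [j]-th generation below [Q] has measure at
    most [lam ^ j |Q|]. The doubling of [Phi] bounds [Phi] of the above sum by a multiple
    of the sum of [c0 ^ j * Phi (A Q)] over the [Q] and [j] such that [x] belongs to
    [layer Q j] ([Phi_sum]); here [c0] may be taken at least 1, since [lam ^ beta < 1].
    Condition F bounds the [w]-integral over [layer Q j] by a multiple of
    [(lam ^ beta) ^ j] times the [v]-integral over the complement in [Q] of
    [layer Q (j + j0)] ([conditionF_nested]). For fixed [N], a point belongs to the
    complement in [Q] of [layer Q N] for at most [N] stopping cubes [Q], and
    [A Q <= MT f x] at the points [x] of [Q]. So the double sum is at most the series of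
    [(c0 * lam ^ beta) ^ j * (j + j0)] times the right-hand side
    ([sparse_integral_le]), and the hypothesis on [c0], [s], [t], [beta] gives the
    convergence of that series. The function [MT f] may fail to be measurable; its
    integral is then a lower integral, and it is compared only with countable sums of
    multiples of [v] restricted to measurable sets.

    The estimate on the whole space follows by Fatou's lemma along the cubes of centre
    0, on which the medians tend to 0 ([integral_le_of_cubes]). *)

(** * Lower integrals and series *)

Section integrals.
Context d (T : measurableType d) (R : realType) (mu : {measure set T -> \bar R}).

(** The integral of a nonnegative function is a supremum over the simple functions
    below it, which makes it monotone also when [g] is not measurable. *)
Lemma ge0_le_lower_integral (D : set T) (f g : T -> \bar R) :
  (forall x, D x -> (0 <= f x)%E) -> (forall x, D x -> (f x <= g x)%E) ->
  (\int[mu]_(x in D) f x <= \int[mu]_(x in D) g x)%E.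
Proof.
move=> f0 fg; rewrite integral_mkcond [leRHS]integral_mkcond.
have f0' x : (0 <= (f \_ D) x)%E by apply: erestrict_ge0 => //; exact: f0.
have fg' x : ((f \_ D) x <= (g \_ D) x)%E.
  by rewrite !patchE; case: ifPn => // /set_mem; exact: fg.
have g0' x : (0 <= (g \_ D) x)%E := le_trans (f0' x) (fg' x).
rewrite !ge0_integralTE//; apply: ereal_sup_le => _ [h hf <-] /=.
by exists h => // x; exact: le_trans (fg' x).
Qed.

Lemma ge0_integral_le_scale (D : set T) (h g : T -> \bar R) (k : R) :
  measurable D -> measurable_fun D h -> 0 <= k ->
  (forall x, D x -> (0 <= h x)%E) ->
  (forall x, D x -> (h x <= k%:E * g x)%E) ->
  (\int[mu]_(x in D) h x <= k%:E * \int[mu]_(x in D) g x)%E.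
Proof.
move=> mD mh k0 h0 hg; have [k_eq0|kn0] := eqVneq k 0.
  rewrite k_eq0 mul0e integral0_eq// => x Dx.
  by apply/eqP; rewrite eq_le h0// andbT; have := hg x Dx; rewrite k_eq0 mul0e.
have kgt0 : 0 < k by rewrite lt_neqAle eq_sym kn0.
have -> : (\int[mu]_(x in D) h x =
    k%:E * \int[mu]_(x in D) ((k^-1)%:E * h x))%E.
  rewrite ge0_integralZl_EFin ?invr_ge0// muleA -EFinM mulfV// mul1e//.
rewrite lee_pmul2l//; apply: ge0_le_lower_integral => x Dx.
  by rewrite mule_ge0 ?lee_fin ?invr_ge0 ?h0.
by rewrite lee_pdivrMl// hg.
Qed.

End integrals.

Lemma nneseries_le_bound (R : realType) (u : nat -> \bar R) (c : \bar R) :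
  (forall n, (0 <= u n)%E) ->
  (forall m, (\sum_(0 <= n < m) u n <= c)%E) -> (\sum_(0 <= n <oo) u n <= c)%E.
Proof.
move=> u0 uc; apply: lime_le; first by apply: is_cvg_nneseries => n _ _.
by near=> m; exact: uc.
Unshelve. all: by end_near. Qed.

Lemma arith_geometric_sum_le (R : realFieldType) (x : R) (j0 n : nat) : 0 <= x < 1 ->
  \sum_(0 <= j < n) x ^+ j * (j + j0)%:R <=
  j0%:R / (1 - x) + x / (1 - x) ^+ 2.
Proof.
move=> /andP[x0 x1]; have y0 : 0 < 1 - x by rewrite subr_gt0.
have yn0 : 1 - x != 0 by rewrite gt_eqF.
(* Adding the tail of the infinite series makes the partial sums constant. *)
suff E : \sum_(0 <= j < n) x ^+ j * (j + j0)%:R +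
    x ^+ n * ((n + j0)%:R / (1 - x) + x / (1 - x) ^+ 2) =
    j0%:R / (1 - x) + x / (1 - x) ^+ 2.
  rewrite -E lerDl mulr_ge0 ?exprn_ge0// addr_ge0//.
    by rewrite divr_ge0// ltW.
  by rewrite divr_ge0// exprn_ge0// ltW.
elim: n => [|n IH]; first by rewrite big_geq// add0r mul1r add0n.
rewrite big_nat_recr//= -IH -!addrA; congr (_ + _).
by rewrite exprS addSn -addn1 !natrD; field.
Qed.

(** * Families of nested cells *)

Section Sparse.
Context d (T : measurableType d) (R : realType) (mu : {measure set T -> \bar R}).
Variables (cell : nat -> set T) (child : nat -> nat -> Prop).
Hypothesis mcell : forall Q, measurable (cell Q).
Hypothesis child_sub : forall Q P, child Q P -> cell P `<=` cell Q.
Hypothesis child_uniq : forall Q P P' x, child Q P -> child Q P' ->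
  cell P x -> cell P' x -> P = P'.

(** Cells are indexed by [nat] so that sums over all of them are series. *)
Fixpoint desc Q j : set nat :=
  if j is j'.+1 then [set P | exists2 P', desc Q j' P' & child P' P] else [set Q].

Definition layer Q j := \bigcup_(P in desc Q j) cell P.

Lemma desc_sub Q j P : desc Q j P -> cell P `<=` cell Q.
Proof.
elim: j P => [P ->//|j IH P [P' /IH P'Q /child_sub PP']].
exact: subset_trans P'Q.
Qed.

Lemma descD Q i j P :
  desc Q (i + j) P <-> exists2 P', desc Q i P' & desc P' j P.
Proof.
elim: j P => [P|j IH P].
  by rewrite addn0; split => [H|[P' H ->]//]; exists P.
rewrite addnS /=; split => [[P1 /IH [P' QP' P'P1] P1P]|[P' QP' [P1 P'P1 P1P]]].
  by exists P' => //; exists P1.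
by exists P1 => //; apply/IH; exists P'.
Qed.

Lemma desc_uniq Q j P P' x : desc Q j P -> desc Q j P' ->
  cell P x -> cell P' x -> P = P'.
Proof.
elim: j P P' => [P P' -> ->//|j IH P P' [P1 d1 c1] [P2 d2 c2] Px P'x].
have E : P1 = P2 by apply: IH d1 d2 _ _; [exact: child_sub Px|exact: child_sub P'x].
by apply: child_uniq c1 _ Px P'x; rewrite E.
Qed.

Lemma layer_measurable Q j : measurable (layer Q j).
Proof. by apply: bigcup_measurable. Qed.

Lemma layer0 Q : layer Q 0 = cell Q.
Proof. by rewrite /layer bigcup_set1. Qed.

Lemma layer_sub Q j : layer Q j `<=` cell Q.
Proof. by move=> x [P /desc_sub]; apply. Qed.

Lemma layerD Q i j : layer Q (i + j) = \bigcup_(P in desc Q i) layer P j.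
Proof.
apply/seteqP; split => x.
  by move=> [P /descD[P' QP' P'P] Px]; exists P' => //; exists P.
by move=> [P' QP' [P P'P Px]]; exists P => //; apply/descD; exists P'.
Qed.

Lemma layer_le Q i j : (i <= j)%N -> layer Q j `<=` layer Q i.
Proof.
move=> ij; rewrite -(subnKC ij) layerD => x [P QP /layer_sub Px]; by exists P.
Qed.

Lemma layer_measure (lam : R) Q j : 0 <= lam ->
  (forall Q, mu (layer Q 1) <= lam%:E * mu (cell Q))%E ->
  (mu (layer Q j) <= (lam ^+ j)%:E * mu (cell Q))%E.
Proof.
move=> l0 H; elim: j => [|j IH]; first by rewrite layer0 mul1e.
rewrite exprS EFinM -muleA; apply: le_trans (lee_wpmul2l _ IH); last by rewrite lee_fin.
pose D := desc Q j.
have tD : trivIset D cell.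
  move=> P P' DP DP' [x [Px P'x]]; exact: desc_uniq DP DP' Px P'x.
have E : layer Q j.+1 = \bigcup_n (if n \in D then layer n 1 else set0).
  rewrite -addn1 layerD; apply/seteqP; split => x.
    by move=> [P DP Px]; exists P => //; rewrite mem_set.
  by move=> [n _]; case: ifPn => // /set_mem Dn xn; exists n.
have mF n : measurable (if n \in D then layer n 1 else set0).
  by case: ifPn => // _; exact: layer_measurable.
apply: le_trans.
  apply: (measure_sigma_subadditive mu mF (layer_measurable Q j.+1)).
  by rewrite E.
have -> : (mu (layer Q j) = \sum_(0 <= n <oo) (if n \in D then mu (cell n) else 0))%E.
  by rewrite /layer measure_bigcup ?eseries_mkcond//.
rewrite -nneseriesZl//; last by move=> n _; case: ifPn.
apply: lee_nneseries => n _; [by []|].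
by case: ifPn => // _; rewrite ?measure0 ?mule0.
Qed.

Lemma layer_limit_null (lam : R) Q : 0 <= lam < 1 ->
  (forall Q, mu (layer Q 1) <= lam%:E * mu (cell Q))%E -> (mu (cell Q) < +oo)%E ->
  mu (\bigcap_j layer Q j) = 0%E.
Proof.
move=> /andP[l0 l1] H Qoo.
have Qfin : mu (cell Q) \is a fin_num by rewrite ge0_fin_numE.
have mI : measurable (\bigcap_j layer Q j).
  by apply: bigcapT_measurable => j; exact: layer_measurable.
apply/eqP; rewrite eq_le measure_ge0 andbT.
have cv : ((lam ^+ j * fine (mu (cell Q)))%:E @[j --> \oo] --> 0%:E)%E.
  apply/cvg_EFin; first by near=> j.
  rewrite -(mul0r (fine (mu (cell Q)))); apply: cvgMl.
  by apply: cvg_expr; rewrite ger0_norm.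
rewrite -[leRHS](cvg_lim _ cv)//; apply: lime_ge; first by apply/cvg_ex; exists 0%:E.
near=> j; rewrite EFinM fineK//; apply: le_trans (layer_measure Q j l0 H).
by apply: le_measure; rewrite ?inE//; [exact: layer_measurable|exact: bigcap_inf].
Unshelve. all: by end_near. Qed.

(** If [k] is the last generation with a cell containing [x], the cell in question is
    the one of generation [k - l] that contains [x]. *)
Lemma layer_diff_uniq q0 i i' l Q Q' x : desc q0 i Q -> desc q0 i' Q' ->
  (layer Q l `\` layer Q l.+1) x -> (layer Q' l `\` layer Q' l.+1) x -> Q = Q'.
Proof.
wlog ii : i i' Q Q' / (i <= i')%N.
  move=> W dQ dQ' lx lx'; have [ii|/ltnW ii] := leqP i i'; first exact: (W i i').
  by apply/esym; exact: (W i' i).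
move=> dQ dQ' [lx nlx] [lx' nlx'].
have Qx := layer_sub lx; have Qx' := layer_sub lx'.
move: ii; rewrite leq_eqVlt => /orP[/eqP ii|ii].
  by rewrite ii in dQ; exact: desc_uniq dQ dQ' Qx Qx'.
exfalso; apply: nlx; case: lx' => P Q'P Px.
have : desc q0 (i + l.+1 + (i' - i.+1)) P.
  have -> : (i + l.+1 + (i' - i.+1))%N = (i' + l)%N.
    by rewrite addnS -addSn addnAC subnKC //=.
  by apply/descD; exists Q'.
move=> /descD[P1 /descD[Q1 dQ1 Q1P1] /desc_sub /(_ _ Px) P1x].
exists P1 => //; have -> // : Q = Q1.
by apply: desc_uniq dQ dQ1 Qx _; exact: desc_sub Q1P1 _ P1x.
Qed.

Lemma desc_path Q k P : desc Q k P -> exists q : nat -> nat,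
  [/\ q 0%N = Q, q k = P & forall i, (i < k)%N -> child (q i) (q i.+1)].
Proof.
elim: k P => [P ->|k IH P [P' /IH[q [q0 qk qc]] P'P]]; first by exists (fun=> Q).
exists (fun i => if (i <= k)%N then q i else P); rewrite ltnn; split => // i ik.
rewrite -ltnS ik; case: ltnP => ik'; first by apply: qc.
by have -> : i = k; [apply/eqP; rewrite eqn_leq ik' -ltnS ik|rewrite qk].
Qed.

Lemma path_desc (q : nat -> nat) k i : (forall i, (i < k)%N -> child (q i) (q i.+1)) ->
  (i <= k)%N -> desc (q i) (k - i) (q k).
Proof.
elim: k => [|k IH] qc ik; first by move: ik; rewrite leqn0 => /eqP ->.
move: ik; rewrite leq_eqVlt => /orP[/eqP ->|ik]; first by rewrite subnn.
rewrite subSn//; exists (q k); last exact: qc.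
by apply: IH => // j jk; apply: qc; exact: leqW.
Qed.


Variables (q0 : nat) (v H : T -> R) (b : nat -> R).
Hypotheses (mv : measurable_fun setT v) (v0 : forall x, 0 <= v x).
Hypotheses (b0 : forall Q, 0 <= b Q) (H0 : forall x, 0 <= H x).
Hypothesis bvH : forall i Q x, desc q0 i Q -> cell Q x -> b Q * v x <= H x.

Let fam : set nat := [set Q | exists i, desc q0 i Q].

Let coef Q : R := if Q \in fam then b Q else 0.

Let coef_ge0 Q : 0 <= coef Q.
Proof. by rewrite /coef; case: ifP. Qed.

Let coef_fam Q : fam Q -> coef Q = b Q.
Proof. by move=> fQ; rewrite /coef mem_set. Qed.

Lemma layer_diff_sum_le l m x :
  \sum_(0 <= Q < m) coef Q * \1_(layer Q l `\` layer Q l.+1) x * v x <= H x.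
Proof.
pose P Q := fam Q /\ (layer Q l `\` layer Q l.+1) x.
have z Q : ~ P Q -> coef Q * \1_(layer Q l `\` layer Q l.+1) x * v x = 0.
  move=> nP; rewrite /coef; case: ifPn => [/set_mem fQ|_]; last by rewrite !mul0r.
  by rewrite indicE memNset ?mulr0 ?mul0r// => lx; apply: nP.
have [[Q [PQm PQ]]|no] := pselect (exists Q, (Q < m)%N /\ P Q); last first.
  rewrite big_nat big1 ?H0// => Q /andP[_ Qm]; apply: z => PQ.
  by apply: no; exists Q.
rewrite (bigD1_seq Q) ?mem_index_iota ?iota_uniq//= big1 ?addr0; last first.
  move=> Q' Q'Q; apply: z => -[[i' fQ'] lQ'].
  case: PQ => -[i fQ] lQ; move/eqP: Q'Q; apply.
  exact: layer_diff_uniq fQ' fQ lQ' lQ.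
case: PQ => -[i fQ] lQ; rewrite coef_fam; last by exists i.
rewrite indicE mem_set// mulr1; apply: bvH fQ _.
by case: lQ => /layer_sub.
Qed.

(** The complement of the [N]-th layer is the union of [N] differences of
    consecutive layers. *)
Lemma indic_layer_diff Q N x : (\1_(cell Q `\` layer Q N) x : R) <=
  \sum_(l < N) \1_(layer Q l `\` layer Q l.+1) x.
Proof.
elim: N => [|N IH].
  by rewrite layer0 setDv indic0 big_ord0.
rewrite big_ord_recr /= !indicE; have [xN|xN] := pselect (layer Q N x).
  have [xN1|xN1] := pselect (layer Q N.+1 x).
    rewrite memNset; last by case.
    by rewrite addr_ge0// ?sumr_ge0.
  have -> : (x \in layer Q N `\` layer Q N.+1) by rewrite mem_set.
  by rewrite ler_wpDl ?sumr_ge0// ler_nat leq_b1.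
have -> : (x \in layer Q N `\` layer Q N.+1) = false by rewrite memNset//; case.
rewrite addr0.
apply: le_trans IH; rewrite indicE ler_nat.
have [/set_mem [Qx _]|] := boolP (x \in cell Q `\` layer Q N.+1); last by [].
by rewrite mem_set.
Qed.

Lemma sparse_sum_le N x :
  (\sum_(0 <= Q <oo) (coef Q * \1_(cell Q `\` layer Q N) x * v x)%:E
   <= (N%:R * H x)%:E)%E.
Proof.
apply: nneseries_le_bound => [Q|m].
  by rewrite lee_fin !mulr_ge0.
rewrite sumEFin lee_fin.
apply: (@le_trans _ _ (\sum_(0 <= Q < m) \sum_(l < N)
    coef Q * \1_(layer Q l `\` layer Q l.+1) x * v x)).
  apply: ler_sum => Q _; rewrite -mulr_suml -mulr_sumr.
  by rewrite ler_wpM2r// ler_wpM2l// indic_layer_diff.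
rewrite exchange_big /= mulr_natl -[N in X in _ <= X]card_ord -sumr_const.
by apply: ler_sum => l _; exact: layer_diff_sum_le.
Qed.

Variables (w F : T -> R) (c r C S : R) (j0 : nat).
Hypotheses (mw : measurable_fun setT w) (w0 : forall x, 0 <= w x).
Hypotheses (mF : measurable_fun setT F) (F0 : forall x, 0 <= F x).
Hypotheses (c0 : 0 <= c) (r0 : 0 <= r) (C0 : 0 <= C).
Hypothesis wv : forall i Q j, desc q0 i Q ->
  (\int[mu]_(x in layer Q j) (w x)%:E <=
   (C * r ^+ j)%:E * \int[mu]_(x in cell Q `\` layer Q (j + j0)) (v x)%:E)%E.
Hypothesis Fw : \forall x \ae mu, cell q0 x -> exists k, exists q : nat -> nat,
  [/\ q 0%N = q0, cell (q k) x, forall i, (i < k)%N -> child (q i) (q i.+1) &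
    F x <= (\sum_(i < k.+1) c ^+ (k - i) * b (q i)) * w x].
Hypothesis HS : forall n, \sum_(0 <= j < n) (c * r) ^+ j * (j + j0)%:R <= S.

Let G (x : T) : \bar R := (\sum_(0 <= j <oo) \sum_(0 <= Q <oo)
  (c ^+ j * coef Q * \1_(layer Q j) x * w x)%:E)%E.

(** The [i]-th term of the sum along the path occurs in the double series at the
    indices [j = k - i] and [Q = q i]; distinct [i] use distinct [j]. *)
Lemma path_sum_le_series (k : nat) (q : nat -> nat) x :
  q 0%N = q0 -> cell (q k) x -> (forall i, (i < k)%N -> child (q i) (q i.+1)) ->
  (((\sum_(i < k.+1) c ^+ (k - i) * b (q i)) * w x)%:E <= G x)%E.
Proof.
move=> q00 xk qc.
have t0 j Q : (0 <= (c ^+ j * coef Q * \1_(layer Q j) x * w x)%:E)%E.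
  by rewrite lee_fin !mulr_ge0// exprn_ge0.
apply: (@le_trans _ _ (\sum_(0 <= j < k.+1) \sum_(0 <= Q <oo)
    (c ^+ j * coef Q * \1_(layer Q j) x * w x)%:E)%E); last first.
  apply: nneseries_lim_ge => j _ _; exact: nneseries_ge0.
rewrite mulr_suml -sumEFin big_mkord (reindex_inj rev_ord_inj) /=.
apply: lee_sum => i _; rewrite subSS subKn; last by rewrite -ltnS.
have ik : (k - i <= k)%N by rewrite leq_subr.
have fQ : desc q0 (k - i) (q (k - i)%N).
  have qc' m : (m < k - i)%N -> child (q m) (q m.+1).
    by move=> mi; apply: qc; exact: leq_trans ik.
  by have := path_desc qc' (leq0n (k - i)); rewrite subn0 q00.
apply: le_trans (nneseries_lim_ge (q (k - i)%N).+1 _) => [|Q _ _ //].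
rewrite big_nat_recr//= -[leLHS]add0e leeD//; first exact: sume_ge0.
rewrite coef_fam; last by exists (k - i)%N.
rewrite indicE mem_set ?mulr1//; exists (q k) => //.
by have := path_desc qc ik; rewrite subKn// -ltnS.
Qed.

(** Summation over all cells of the tree: the [w]-integrals over the layers decay
    geometrically, and the [v]-integrals off the [N]-th layers overlap at most [N]
    times. *)
Theorem sparse_integral_le :
  (\int[mu]_(x in cell q0) (F x)%:E <= (C * S)%:E * \int[mu]_(x in cell q0) (H x)%:E)%E.
Proof.
have mwE A : measurable A -> measurable_fun A (EFin \o w).
  by move=> mA; apply/measurable_EFinP; exact: measurable_funS mw.
have mvE A : measurable A -> measurable_fun A (EFin \o v).
  by move=> mA; apply/measurable_EFinP; exact: measurable_funS mv.
have mind A : measurable A -> measurable_fun setT (\1_A : T -> R).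
  by move=> mA; exact: measurable_indic.
have mt j Q : measurable_fun (cell q0)
    (fun x => (c ^+ j * coef Q * \1_(layer Q j) x * w x)%:E).
  apply/measurable_EFinP/(measurable_funS measurableT) => //.
  apply: measurable_funM => //; apply: measurable_funM => //.
  by apply: mind; exact: layer_measurable.
have mh N Q : measurable_fun (cell q0)
    (fun x => (coef Q * \1_(cell Q `\` layer Q N) x * v x)%:E).
  apply/measurable_EFinP/(measurable_funS measurableT) => //.
  apply: measurable_funM => //; apply: measurable_funM => //.
  by apply: mind; apply: measurableD => //; exact: layer_measurable.
have t0 j Q x : (0 <= (c ^+ j * coef Q * \1_(layer Q j) x * w x)%:E)%E.
  by rewrite lee_fin !mulr_ge0// exprn_ge0.
have h0 N Q x : (0 <= (coef Q * \1_(cell Q `\` layer Q N) x * v x)%:E)%E.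
  by rewrite lee_fin !mulr_ge0.
have mG1 j : measurable_fun (cell q0) (fun x => \sum_(0 <= Q <oo)
    (c ^+ j * coef Q * \1_(layer Q j) x * w x)%:E)%E.
  by apply: ge0_emeasurable_sum.
have mG : measurable_fun (cell q0) G.
  by apply: ge0_emeasurable_sum => // j x _ _; exact: nneseries_ge0.
have G0 x : (0 <= G x)%E by apply: nneseries_ge0 => j _ _; exact: nneseries_ge0.
apply: (@le_trans _ _ (\int[mu]_(x in cell q0) G x)%E).
  apply: ae_ge0_le_integral => //.
  - by move=> x _; rewrite lee_fin.
  - by apply/measurable_EFinP; exact: measurable_funS mF.
  apply: filterS Fw => x Fx /Fx[k [q [q00 xk qc Fxk]]].
  by apply: le_trans (path_sum_le_series q00 xk qc); rewrite lee_fin.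
rewrite /G integral_nneseries//; last by move=> j x _; exact: nneseries_ge0.
pose I := (\int[mu]_(x in cell q0) (H x)%:E)%E.
have I0 : (0 <= I)%E by apply: integral_ge0 => x _; rewrite lee_fin.
have layerE Q (A : set T) (g : T -> R) (mA : measurable A) (a : R) : fam Q -> A `<=` cell Q ->
    measurable_fun setT g -> (forall x, 0 <= g x) -> 0 <= a ->
    (\int[mu]_(x in cell q0) (a * \1_A x * g x)%:E =
     a%:E * \int[mu]_(x in A) (g x)%:E)%E.
  move=> [i fQ] AQ mg g0 a0.
  have AE : A = cell q0 `&` A.
    by apply/esym/setIidr; apply: subset_trans AQ _; exact: desc_sub fQ.
  have mgE : measurable_fun A (EFin \o g).
    by apply/measurable_EFinP; exact: measurable_funS mg.
  rewrite -ge0_integralZl_EFin//; last by move=> x _; rewrite lee_fin.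
  rewrite [in RHS]AE integral_mkcondr; apply: eq_integral => x _.
  by rewrite epatch_indic /= -!EFinM; congr EFin; ring.
apply: (@le_trans _ _ (\sum_(0 <= j <oo) ((C * (c * r) ^+ j * (j + j0)%:R)%:E * I))%E).
  apply: lee_nneseries => [j _ _|j _].
    by apply: integral_ge0 => x _; exact: nneseries_ge0.
  rewrite integral_nneseries//.
  apply: (@le_trans _ _ (\sum_(0 <= Q <oo) (C * (c * r) ^+ j)%:E *
      \int[mu]_(x in cell q0) (coef Q * \1_(cell Q `\` layer Q (j + j0)) x * v x)%:E)%E).
    apply: lee_nneseries => [Q _ _|Q _]; first by apply: integral_ge0.
    have [fQ|nfQ] := pselect (fam Q); last first.
      have -> : coef Q = 0 by rewrite /coef memNset.
      rewrite [leLHS]integral0_eq; last by move=> x _; rewrite mulr0 !mul0r.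
      by rewrite [X in (_ * X)%E]integral0_eq ?mule0// => x _; rewrite !mul0r.
    have mQj := layer_measurable Q j; have mQN := layer_measurable Q (j + j0).
    have Qj := @layer_sub Q j.
    rewrite (layerE Q)//; last by rewrite mulr_ge0 ?exprn_ge0.
    rewrite (layerE Q)//; last exact: measurableD.
    rewrite exprMn mulrA (mulrC C) muleA -EFinM.
    have [i fQ'] := fQ.
    apply: (@le_trans _ _ ((c ^+ j * coef Q)%:E * ((C * r ^+ j)%:E *
      \int[mu]_(x in cell Q `\` layer Q (j + j0)) (v x)%:E))%E).
      by rewrite lee_wpmul2l ?(wv _ fQ')// lee_fin mulr_ge0 ?exprn_ge0.
    rewrite muleA -EFinM le_eqVlt; apply/orP; left; apply/eqP; congr (_%:E * _)%E; ring.
  rewrite nneseriesZl; last by move=> Q _; exact: integral_ge0.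
  rewrite -integral_nneseries//.
  rewrite [in leRHS]EFinM -[leRHS]muleA lee_wpmul2l//.
    by rewrite lee_fin !mulr_ge0 ?exprn_ge0 ?mulr_ge0.
  apply: ge0_integral_le_scale => //.
  - by apply: ge0_emeasurable_sum.
  - by move=> x _; exact: nneseries_ge0.
  - by move=> x _; rewrite -EFinM; exact: sparse_sum_le.
apply: nneseries_le_bound => [j|m].
  by rewrite mule_ge0// lee_fin !mulr_ge0// exprn_ge0// mulr_ge0.
rewrite -ge0_sume_distrl; last by move=> j _; rewrite lee_fin !mulr_ge0// exprn_ge0// mulr_ge0.
rewrite lee_wpmul2r// sumEFin lee_fin.
under eq_bigr do rewrite -mulrA.
by rewrite -mulr_sumr ler_wpM2l.
Qed.

End Sparse.

(** * Half-open cubes and the dyadic grid *)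

Section Geometry.
Variables (R : realType) (n : nat).
Local Notation mu := (leb R n).

Lemma borel_measurable_Rn (A : set (n.-tuple R)) :
  measurable A -> measurable (A : set (Rn R n)).
Proof. by move=> mA; apply: sub_caratheodory; apply: sub_sigma_algebra. Qed.

Lemma measurable_Rn_coord i (B : set R) :
  measurable B -> measurable [set x : Rn R n | B (Rn_coord x i)].
Proof.
move=> mB; apply: borel_measurable_Rn; rewrite -[X in measurable X]setTI.
exact: (@measurable_tnth _ R n i measurableT B mB).
Qed.

Lemma leb_box (a b : 'I_n -> R) : (forall i, a i <= b i) ->
  let B := [set x : Rn R n | forall i, a i <= Rn_coord x i <= b i] in
  measurable B /\ mu B = (\prod_i (b i - a i))%:E.
Proof.
move=> ab B; have [m e] := borel_lebesgue_box ab; split.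
  exact: (borel_measurable_Rn m).
by etransitivity; [exact: (measurable_mu_extE (borel_lebesgue R n) m)|exact: e].
Qed.

Definition hcube (a : Rn R n) (l : R) : set (Rn R n) :=
  [set x | forall i, Rn_coord a i <= Rn_coord x i < Rn_coord a i + l].

Lemma hcube_sub a l : hcube a l `<=` cube a l.
Proof. by move=> x H i; have /andP[-> /ltW ->] := H i. Qed.

Lemma measurable_hcube a l : measurable (hcube a l).
Proof.
rewrite (_ : hcube a l = \bigcap_(i in setT)
   [set x | `[Rn_coord a i, Rn_coord a i + l[%classic (Rn_coord x i)]).
  apply: fin_bigcap_measurable => [|i _]; first exact: finite_finset.
  exact: measurable_Rn_coord.
apply/seteqP; split => x /= H i; first by move=> _ /=; rewrite in_itv /=; exact: H.
by have := H i I; rewrite /= in_itv.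
Qed.

Lemma measurable_cube a l : 0 <= l -> measurable (cube (a : Rn R n) l).
Proof. by move=> /(@leb_cube R n a)[]. Qed.

(** The faces of a cube are degenerate boxes. *)
Lemma leb_cubeD_hcube a l : 0 < l -> mu (cube a l `\` hcube a l) = 0%E.
Proof.
move=> l0.
have mc : measurable (cube a l) by apply: measurable_cube; exact: ltW.
pose face i := [set x : Rn R n | forall j,
  (if j == i then Rn_coord a j + l else Rn_coord a j) <= Rn_coord x j <=
  Rn_coord a j + l].
have Hf i : measurable (face i) /\ mu (face i) = 0%E.
  have [|m e] := @leb_box (fun j => if j == i then Rn_coord a j + l else Rn_coord a j)
    (fun j => Rn_coord a j + l).
    by move=> j; case: ifP; rewrite ?lerDl// ltW.
  by split=> //; rewrite [LHS]e (bigD1 i)//= eqxx subrr mul0r.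
have sub : cube a l `\` hcube a l `<=` \big[setU/set0]_(i < n) face i.
  move=> x [cx /existsNP[i nhi]]; rewrite -bigcup_seq /=.
  exists i => [|j]; first by rewrite /= mem_index_enum.
  have := cx j; case: eqVneq => [->|//] /andP[ai ->]; rewrite andbT leNgt.
  by apply/negP => xi; apply: nhi; rewrite ai.
apply: measure_negligible; first by apply: measurableD => //; exact: measurable_hcube.
apply: negligibleS sub _; elim/big_ind: _ => [|A B nA nB|i _].
- exact: negligible_set0.
- exact: negligibleU.
- by apply/negligibleP; have [] := Hf i.
Qed.

Lemma leb_hcube a l : 0 < l -> mu (hcube a l) = (l ^+ n)%:E.
Proof.
move=> l0; have [mc <-] := leb_cube a (ltW l0).
have mh := measurable_hcube a l.
have mD : measurable (cube a l `\` hcube a l) by exact: measurableD.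
rewrite -[in RHS](setDUK (@hcube_sub a l)) measureU ?setDIK//.
by rewrite [X in (_ + X)%E]leb_cubeD_hcube// adde0.
Qed.

Lemma ge0_integral_null_diff (A B : set (Rn R n)) (f : Rn R n -> \bar R) :
  measurable A -> measurable B -> A `<=` B -> mu (B `\` A) = 0%E ->
  measurable_fun B f -> (forall x, B x -> (0 <= f x)%E) ->
  (\int[mu]_(x in A) f x = \int[mu]_(x in B) f x)%E.
Proof.
move=> mA mB AB null mf f0.
rewrite [RHS](ge0_negligible_integral _ mB mf f0 null); last exact: measurableD.
by rewrite setDD setIidr.
Qed.

Variables (a : Rn R n) (l : R).
Hypothesis l0 : 0 < l.

Definition grid_side k : R := l / 2 ^+ k.

Lemma grid_side_gt0 k : 0 < grid_side k.
Proof. by rewrite divr_gt0// exprn_gt0. Qed.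

Definition rel_coord k (x : Rn R n) i := (Rn_coord x i - Rn_coord a i) / grid_side k.

(** Two points have the same code at level [k] when they lie in the same cell of the
    grid of mesh [grid_side k] based at [a]. The code is a number so that the cells of
    a level form a sequence. *)
Definition grid_code k (x : Rn R n) : nat :=
  pickle [ffun i : 'I_n => Num.floor (rel_coord k x i)].

Definition grid_corner k x : Rn R n :=
  [tuple Rn_coord a i + (Num.floor (rel_coord k x i))%:~R * grid_side k | i < n].

Lemma grid_cornerE k x i :
  Rn_coord (grid_corner k x) i =
  Rn_coord a i + (Num.floor (rel_coord k x i))%:~R * grid_side k.
Proof. by rewrite /Rn_coord tnth_mktuple. Qed.

Lemma grid_code_eqP k x y : grid_code k y = grid_code k x <->
  forall i, Num.floor (rel_coord k y i) = Num.floor (rel_coord k x i).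
Proof.
split=> [/(pcan_inj pickleK) /ffunP H i|H]; first by have := H i; rewrite !ffunE.
by congr pickle; apply/ffunP => i; rewrite !ffunE.
Qed.

Lemma grid_code_hcube k x :
  [set y | grid_code k y = grid_code k x] = hcube (grid_corner k x) (grid_side k).
Proof.
have s0 := grid_side_gt0 k.
apply/seteqP; split => y /=.
  move=> /grid_code_eqP H i; rewrite grid_cornerE -H.
  have /andP[] := floor_itv (rel_coord k y i); rewrite intrD /rel_coord.
  rewrite ler_pdivlMr// ltr_pdivrMr//; nra.
move=> H; apply/grid_code_eqP => i; apply: floor_def.
have := H i; rewrite grid_cornerE intrD {3 4}/rel_coord ler_pdivlMr// ltr_pdivrMr//.
by move=> /andP[? ?]; apply/andP; split; nra.
Qed.

Lemma floor_double (r : R) : exists b : bool,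
  Num.floor (2 * r) = 2 * Num.floor r + b%:Z.
Proof.
have /andP[h1 h2] := floor_itv r.
have [h|h] := ltP (2 * r) (2 * (Num.floor r)%:~R + 1); [exists false|exists true];
  apply: floor_def; move: h1 h2 h; rewrite !(intrD, intrM) /=; lra.
Qed.

Lemma rel_coordS k x i : rel_coord k.+1 x i = 2 * rel_coord k x i.
Proof.
rewrite /rel_coord /grid_side exprS; field.
by rewrite expf_neq0// gt_eqF.
Qed.

Lemma grid_code_coarser k m x y : (k <= m)%N ->
  grid_code m y = grid_code m x -> grid_code k y = grid_code k x.
Proof.
move=> /subnKC <-; elim: (m - k)%N => [|j IH]; first by rewrite addn0.
rewrite addnS => H; apply: IH; move: H => /grid_code_eqP H; apply/grid_code_eqP => i.
have := H i; rewrite !rel_coordS.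
have [b ->] := floor_double (rel_coord (k + j) y i).
have [b' ->] := floor_double (rel_coord (k + j) x i).
by case: b; case: b'; lia.
Qed.

Lemma measurable_grid_code k j : measurable [set y | grid_code k y = j].
Proof.
have [[x <-]|no] := pselect (exists x, grid_code k x = j).
  by rewrite grid_code_hcube; exact: measurable_hcube.
rewrite (_ : [set _ | _] = set0)//.
by apply/seteqP; split => // x xj; apply: no; exists x.
Qed.


(** The unions of cells of level [k]. *)
Definition gridset k (D : set (Rn R n)) :=
  forall x y, grid_code k x = grid_code k y -> D x -> D y.

Lemma gridset_finer k m D : (k <= m)%N -> gridset k D -> gridset m D.
Proof. by move=> km gD x y /(grid_code_coarser km); exact: gD. Qed.

Lemma gridset_measurable k D : gridset k D -> measurable D.
Proof.
move=> gD; rewrite (_ : D = \bigcup_(j in grid_code k @` D) [set y | grid_code k y = j]).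
  by apply: bigcup_measurable => j _; exact: measurable_grid_code.
apply/seteqP; split => [x Dx|y [_ [x Dx <-] yx]]; last exact: gD (esym yx) Dx.
by exists (grid_code k x) => //; exists x.
Qed.

Section grid_approximation.
Variable Q : set (Rn R n).
Hypotheses (mQ : measurable Q) (Qfin : (mu Q < +oo)%E).

Let dist A B := mu (Q `&` ((A `\` B) `|` (B `\` A))).

Let mdist A B : measurable A -> measurable B ->
  measurable (Q `&` ((A `\` B) `|` (B `\` A))).
Proof.
by move=> mA mB; apply: measurableI => //; apply: measurableU; exact: measurableD.
Qed.

Let dist_triangle A B C : measurable A -> measurable B -> measurable C ->
  (dist A C <= dist A B + dist B C)%E.
Proof.
move=> mA mB mC; rewrite /dist.
apply: le_trans (measureU2 _ (mdist mA mB) (mdist mB mC)).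
apply: le_measure; rewrite ?inE; [exact: mdist|apply: measurableU; exact: mdist|].
move=> x [Qx]; have [Bx|Bx] := pselect (B x) => -[[? ?]|[? ?]].
- by right; split => //; left.
- by left; split => //; right.
- by left; split => //; left.
- by right; split => //; right.
Qed.

Let approx (E : set (Rn R n)) := measurable E /\
  forall e, 0 < e -> exists k D, gridset k D /\ (dist E D <= e%:E)%E.

Let approx_limit E : measurable E ->
  (forall e, 0 < e -> exists2 E', approx E' & (dist E E' <= e%:E)%E) -> approx E.
Proof.
move=> mE H; split => // e e0; have e2 : 0 < e / 2 by rewrite divr_gt0.
have [E' [mE' /(_ _ e2) [k [D [gD E'D]]]] EE'] := H _ e2.
exists k, D; split => //; rewrite (splitr e) EFinD.
apply: le_trans (dist_triangle mE mE' (gridset_measurable gD)) _.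
exact: leeD.
Qed.

Let approx_set0 : approx set0.
Proof.
split => // e e0; exists 0%N, set0; split => //.
by rewrite /dist set0D setU0 setI0 measure0 lee_fin ltW.
Qed.

Let approxC E : approx E -> approx (~` E).
Proof.
move=> [mE H]; split; first exact: measurableC.
move=> e /H [k [D [gD ED]]]; exists k, (~` D); split.
  by move=> x y xy nDx Dy; apply: nDx; exact: gD (esym xy) Dy.
by rewrite /dist !setDE !setCK setUC (setIC _ E) (setIC _ D) -!setDE.
Qed.

Let approxU A B : approx A -> approx B -> approx (A `|` B).
Proof.
move=> [mA HA] [mB HB]; split; first exact: measurableU.
move=> e e0; have e2 : 0 < e / 2 by rewrite divr_gt0.
have [k [D [gD AD]]] := HA _ e2; have [m [D' [gD' BD]]] := HB _ e2.
have mD := gridset_measurable gD; have mD' := gridset_measurable gD'.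
exists (maxn k m), (D `|` D'); split.
  move=> x y xy [Dx|Dx]; [left|right].
    exact: (gridset_finer (leq_maxl k m) gD) xy Dx.
  exact: (gridset_finer (leq_maxr k m) gD') xy Dx.
rewrite (splitr e) EFinD; apply: le_trans (leeD AD BD).
apply: le_trans (measureU2 _ (mdist mA mD) (mdist mB mD')).
apply: le_measure; rewrite ?inE; [by apply: mdist; exact: measurableU
  |by apply: measurableU; exact: mdist|].
move=> x [Qx] [[[Ax|Bx] nD]|[[Dx|Dx] nAB]].
- by left; split => //; left; split => // Dx; apply: nD; left.
- by right; split => //; left; split => // Dx; apply: nD; right.
- by left; split => //; right; split => // Dx'; apply: nAB; left.
- by right; split => //; right; split => // Dx'; apply: nAB; right.
Qed.

Let approx_bigcup (F : nat -> set (Rn R n)) : (forall i, approx (F i)) ->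
  approx (\bigcup_i F i).
Proof.
move=> HF; have mF i : measurable (F i) by case: (HF i).
have mU : measurable (\bigcup_i F i) by exact: bigcupT_measurable.
apply: approx_limit => // e e0.
pose G N := Q `&` (\bigcup_i F i `\` \big[setU/set0]_(i < N) F i).
have mG N : measurable (G N).
  apply: measurableI => //; apply: measurableD => //; exact: bigsetU_measurable.
have G0 : \bigcap_N G N = set0.
  apply/seteqP; split => // x GN.
  have [_ [[i _ Fix] _]] := GN 0%N I; have [_ [_]] := GN i.+1 I; apply.
  by rewrite -bigcup_mkord; exists i => /=.
have cvG : mu (G N) @[N --> \oo] --> mu (\bigcap_N G N).
  apply: nonincreasing_cvg_mu => //.
  - apply: le_lt_trans Qfin; apply: le_measure; rewrite ?inE//; exact: subIsetl.
  - by rewrite G0.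
  - move=> N M NM; apply/subsetPset; apply: setIS; apply: setDS.
    exact: subset_bigsetU.
rewrite G0 measure0 in cvG.
have : \forall N \near \oo, (mu (G N) < e%:E)%E.
  have e0' : (0 < e%:E)%E by rewrite lte_fin.
  exact: cvG _ (open_ereal_lt' e0').
move=> [N _ /(_ N (leqnn N)) /= HN]; exists (\big[setU/set0]_(i < N) F i).
  by elim/big_ind: _ => // A B; exact: approxU.
apply: le_trans (ltW HN); rewrite /dist /G setIUr.
rewrite [X in _ `|` X](_ : _ = set0) ?setU0//.
apply/seteqP; split => // x [Qx [+ nF]]; rewrite -bigcup_mkord => -[i _ Fi].
by apply: nF; exists i.
Qed.

Let approx_ray i (c : R) : approx [set x | Rn_coord x i < c].
Proof.
pose D k := [set x | Rn_coord a i +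
   (Num.floor (rel_coord k x i))%:~R * grid_side k + grid_side k <= c].
rewrite (_ : [set _ | _] = \bigcup_k D k).
  apply: approx_bigcup => k; have gD : gridset k (D k).
    by move=> x y /grid_code_eqP /(_ i); rewrite /D /= => ->.
  split; first exact: gridset_measurable gD.
  move=> e e0; exists k, (D k); split => //.
  by rewrite /dist setDv setU0 setI0 measure0 lee_fin ltW.
apply/seteqP; split => x /=.
  rewrite -subr_gt0 => xc.
  have [k Hk] : exists k, grid_side k <= c - Rn_coord x i.
    exists (Num.bound (l / (c - Rn_coord x i))).
    rewrite /grid_side ler_pdivrMr ?exprn_gt0// mulrC -ler_pdivrMr//.
    apply: (@le_trans _ _ (Num.bound (l / (c - Rn_coord x i)))%:R).
      by apply/ltW/archi_boundP; rewrite divr_ge0// ltW.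
    by rewrite -natrX ler_nat ltnW// ltn_expl.
  exists k => //=; rewrite /D /=.
  have /andP[h _] := floor_itv (rel_coord k x i).
  move: h; rewrite {2}/rel_coord ler_pdivlMr ?grid_side_gt0//; nra.
move=> [k _]; rewrite /D /= => h; apply: lt_le_trans h.
have /andP[_] := floor_itv (rel_coord k x i).
rewrite {1}/rel_coord intrD ltr_pdivrMr ?grid_side_gt0//; nra.
Qed.

Let approx_coord i (B : set R) : measurable B -> approx [set x | B (Rn_coord x i)].
Proof.
move=> mB; have : (@RGenInftyO.G R).-sigma.-measurable B.
  by rewrite -RGenInftyO.measurableE.
move: B {mB}; apply: smallest_sub; last first.
  move=> _ [c ->]; rewrite (_ : [set _ | _] = [set x | Rn_coord x i < c]).
    exact: approx_ray.
  by apply/seteqP; split => x /=; rewrite in_itv.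
split => [|B aB|F aF].
- exact: approx_set0.
- by rewrite setTD; exact: approxC aB.
- rewrite (_ : [set _ | _] = \bigcup_k [set x | F k (Rn_coord x i)]).
    exact: approx_bigcup.
  by apply/seteqP; split.
Qed.

Let approx_borel (B : set (n.-tuple R)) : measurable B -> approx B.
Proof.
move: B; apply: smallest_sub.
  split => [|B aB|F aF]; first exact: approx_set0.
    by rewrite setTD; exact: approxC.
  exact: approx_bigcup.
elim/big_ind: _ => [//|A B HA HB|i _].
  by move=> C [/HA|/HB].
by move=> _ [B mB <-]; rewrite setTI; exact: approx_coord.
Qed.

(** The sets with this property form a sigma-algebra, and half-spaces are countable
    unions of grid sets; so all Borel sets have it. A Lebesgue measurable set of finite
    measure is contained in a Borel set of nearly the same measure. *)
Lemma grid_approx (E : set (Rn R n)) (e : R) : measurable E -> 0 < e ->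
  exists k D, gridset k D /\
    (mu (Q `&` ((E `\` D) `|` (D `\` E))) <= e%:E)%E.
Proof.
move=> mE; suff [_] : approx E by apply.
apply: approx_limit => // {}e e0.
have mEQ : measurable (E `&` Q) by exact: measurableI.
have EQfin : mu (E `&` Q) \is a fin_num.
  rewrite ge0_fin_numE//; apply: le_lt_trans Qfin.
  by apply: le_measure; rewrite ?inE.
have [_ [A [mA EA] <-] Ae] := lb_ereal_inf_adherent e0 EQfin.
have {}mA k : measurable (A k : set (n.-tuple R)) by exact: mA.
have mB : measurable (\bigcup_k A k : set (n.-tuple R)) by exact: bigcupT_measurable.
exists (\bigcup_k A k); first exact: approx_borel.
have mB' : measurable (\bigcup_k A k : set (Rn R n)) by exact: borel_measurable_Rn.
have Be : (mu (\bigcup_k A k) <= mu (E `&` Q) + e%:E)%E.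
  apply: le_trans (ltW Ae).
  apply: le_trans (measure_sigma_subadditive mu _ mB' (@subset_refl _ _)) _.
    by move=> k; exact: borel_measurable_Rn.
  apply: lee_nneseries => [k _ _//|k _].
  by rewrite [leLHS](measurable_mu_extE (borel_lebesgue R n) (mA k)).
have mBD : measurable (\bigcup_k A k `\` (E `&` Q) : set (Rn R n)) by exact: measurableD.
have BE : (mu (\bigcup_k A k) = mu (E `&` Q) + mu (\bigcup_k A k `\` (E `&` Q)))%E.
  by rewrite -[in LHS](setDUK EA) measureU// setDIK.
move: Be; rewrite BE leeD2lE//.
apply: le_trans; apply: le_measure; rewrite ?inE//; first exact: mdist.
move=> x [Qx [[Ex nA]|[Ax nE]]].
  by exfalso; apply: nA; apply: EA.
by split => // -[].
Qed.

End grid_approximation.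

Lemma leb_grid_code_lty k j : (mu [set y | grid_code k y = j] < +oo)%E.
Proof.
have [[x <-]|no] := pselect (exists x, grid_code k x = j).
  by rewrite grid_code_hcube leb_hcube ?grid_side_gt0// ltry.
rewrite (_ : [set _ | _] = set0) ?measure0 ?ltry//.
by apply/seteqP; split => // x xj; apply: no; exists x.
Qed.

Lemma leb_grid_code_partition k (A : set (Rn R n)) : measurable A ->
  mu A = (\sum_(0 <= i <oo) mu (A `&` [set y | grid_code k y = i]))%E.
Proof.
move=> mA; have mP i : measurable (A `&` [set y | grid_code k y = i]).
  by apply: measurableI => //; exact: measurable_grid_code.
rewrite -measure_semi_bigcup//; last exact: bigcupT_measurable.
  by congr (mu _); apply/seteqP; split => [x Ax|x [i _ []]//]; exists (grid_code k x).
by move=> i j _ _ [x [[_ /= <-] [_ /= <-]]].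
Qed.

(** Approximating [E] by a union [D] of fine cells, the hypothesis bounds the measure
    of the intersection of [E] and [D] by [theta] times that of [D], so the measure of
    [E] is at most [theta] times itself. This replaces the Lebesgue density theorem. *)
Lemma grid_density_null m j (E : set (Rn R n)) (theta : R) :
  measurable E -> E `<=` [set y | grid_code m y = j] -> 0 <= theta < 1 ->
  (forall k x, (m <= k)%N -> grid_code m x = j ->
    (mu (E `&` [set y | grid_code k y = grid_code k x]) <=
     theta%:E * mu [set y | grid_code k y = grid_code k x])%E) ->
  mu E = 0%E.
Proof.
move=> mE EQ /andP[t0 t1] H; set Q := [set y | grid_code m y = j] in EQ.
have mQ : measurable Q by exact: measurable_grid_code.
have Qfin : (mu Q < +oo)%E by exact: leb_grid_code_lty.
have Efin : mu E \is a fin_num.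
  rewrite ge0_fin_numE//; apply: le_lt_trans Qfin.
  by apply: le_measure; rewrite ?inE.
suff HE e : 0 < e -> fine (mu E) * (1 - theta) <= e.
  apply/eqP; rewrite eq_le measure_ge0 andbT -(fineK Efin) lee_fin.
  rewrite -(@pmulr_lle0 _ (1 - theta)) ?subr_gt0// mulrC.
  by apply/ler_addgt0Pl => e e0; rewrite addr0 mulrC; exact: HE.
move=> e0; have e2 : 0 < e / 2 by rewrite divr_gt0.
have [k0 [D [gD0 He]]] := grid_approx mQ Qfin mE e2.
pose k := maxn k0 m; have gD := gridset_finer (leq_maxl k0 m) gD0.
have mk : (m <= k)%N := leq_maxr k0 m.
have mD := gridset_measurable gD.
have mDQ : measurable (D `&` Q) by exact: measurableI.
have mED : measurable (E `\` D) by exact: measurableD.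
have mDE : measurable (Q `&` (D `\` E)) by apply: measurableI => //; exact: measurableD.
have mC i : measurable [set y | grid_code k y = i] by exact: measurable_grid_code.
have EDQ : E `&` D = E `&` (D `&` Q).
  by rewrite setIA; apply/esym/setIidPl => x [/EQ].
have step : (mu (E `&` D) <= theta%:E * mu (D `&` Q))%E.
  rewrite EDQ (leb_grid_code_partition k (measurableI _ _ mE mDQ)).
  rewrite [mu (D `&` Q)](leb_grid_code_partition k mDQ) -nneseriesZl//.
  apply: lee_nneseries => [//|i _].
  have [[x [[Dx Qx] xi]]|no] := pselect (exists x, (D `&` Q) x /\ grid_code k x = i).
    have DC : D `&` Q `&` [set y | grid_code k y = i] =
        [set y | grid_code k y = grid_code k x].
      rewrite -xi; apply/seteqP; split => y; first by case.
      move=> /= yx; split => //; split; first exact: gD (esym yx) Dx.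
      exact: etrans (grid_code_coarser mk yx) Qx.
    by rewrite -[X in mu X]setIA DC; exact: H.
  rewrite [X in (mu X <= _)%E](_ : _ = set0) ?measure0 ?mule_ge0//.
  by apply/seteqP; split => // x [[_ DQx] xi]; apply: no; exists x.
have D1 : (mu (E `\` D) + mu (Q `&` (D `\` E)) <= (e / 2)%:E)%E.
  rewrite -measureU//; last first.
    by apply/seteqP; split => // x [[Ex _] [_ []]].
  apply: le_trans He; apply: le_measure; rewrite ?inE//.
  - exact: measurableU.
  - by apply: measurableI => //; apply: measurableU => //; exact: measurableD.
  - by move=> x [[Ex nD]|[Qx DE]]; [split; [exact: EQ|left]|split => //; right].
have D2 : (mu (D `&` Q) <= mu E + mu (Q `&` (D `\` E)))%E.
  apply: le_trans (measureU2 _ mE mDE); apply: le_measure; rewrite ?inE//.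
    exact: measurableU.
  by move=> x [Dx Qx]; have [|] := pselect (E x); [left|right].
have D3 : (mu E <= mu (E `&` D) + mu (E `\` D))%E.
  by rewrite addeC -measureDI.
have fin A : measurable A -> A `<=` Q -> mu A \is a fin_num.
  move=> mA AQ; rewrite ge0_fin_numE//; apply: le_lt_trans Qfin.
  by apply: le_measure; rewrite ?inE.
have f1 : mu (E `&` D) \is a fin_num.
  by apply: fin; [exact: measurableI|move=> x [/EQ]].
have f2 : mu (E `\` D) \is a fin_num by apply: fin => // x [/EQ].
have f3 : mu (Q `&` (D `\` E)) \is a fin_num by apply: fin => // x [].
have f4 : mu (D `&` Q) \is a fin_num by apply: fin => // x [].
move: step D1 D2 D3; rewrite -(fineK Efin) -(fineK f1) -(fineK f2) -(fineK f3) -(fineK f4).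
have := fine_ge0 (measure_ge0 mu (Q `&` (D `\` E))).
have := fine_ge0 (measure_ge0 mu (E `\` D)).
rewrite -!EFinD -EFinM !lee_fin /=.
move: (fine (mu (E `&` D))) (fine (mu (E `\` D))) (fine (mu (Q `&` (D `\` E))))
  (fine (mu (D `&` Q))) (fine (mu E)) => p q r u z q0 r0 h1 h2 h3 h4.
have : theta * u <= theta * (z + r) by rewrite ler_wpM2l.
have : theta * r <= r by rewrite ler_piMl// ltW.
lra.
Qed.

End Geometry.

Lemma powR_le1 (R : realType) (x b : R) : 0 <= b -> 0 <= x <= 1 -> x `^ b <= 1.
Proof.
move=> b0 /andP[x0 x1]; have -> : 1 = 1 `^ b :> R by rewrite powR1.
by apply: ge0_ler_powR; rewrite ?nnegrE.
Qed.

Lemma powR_exprn (R : realType) (x b : R) j : 0 <= x -> (x ^+ j) `^ b = (x `^ b) ^+ j.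
Proof.
move=> x0; elim: j => [|j IH]; first by rewrite !expr0 powR1.
by rewrite !exprS powRM ?exprn_ge0// IH.
Qed.

(** * Condition F on half-open cubes *)

Section ConditionF.
Variables (R : realType) (n : nat).
Hypothesis n_gt0 : (0 < n)%N.
Local Notation mu := (leb R n).

(** Cuts orthogonal to the first coordinate axis. *)
Lemma slab_cover (c : Rn R n) (h : R) (N : nat) : 0 < h -> (0 < N)%N ->
  exists F : nat -> set (Rn R n),
    [/\ forall i, measurable (F i), trivIset setT F,
        \big[setU/set0]_(i <- iota 0 N) F i = hcube c h &
        forall i, (mu (F i) <= (N%:R^-1)%:E * mu (hcube c h))%E].
Proof.
move=> h0 N0; pose i0 := Ordinal n_gt0; pose d := h / N%:R.
have NR0 : 0 < N%:R :> R by rewrite ltr0n.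
have d0 : 0 < d by rewrite divr_gt0.
have hd : h = N%:R * d by rewrite /d mulrCA mulfV ?mulr1// gt_eqF.
pose F i := hcube c h `&` [set x | `[Rn_coord c i0 + i%:R * d,
   Rn_coord c i0 + i.+1%:R * d[%classic (Rn_coord x i0)].
have mF i : measurable (F i).
  by apply: measurableI; [exact: measurable_hcube|exact: measurable_Rn_coord].
exists F; split => //.
- move=> i j _ _ [x [[_ /=]]]; rewrite in_itv /= => /andP[i1 i2].
  move=> [_ /=]; rewrite in_itv /= => /andP[j1 j2].
  have : i%:R * d < j.+1%:R * d by lra.
  have : j%:R * d < i.+1%:R * d by lra.
  rewrite !ltr_pM2r// !ltr_nat; lia.
- apply/seteqP; split => x.
    by rewrite -bigcup_seq => -[i _ []].
  move=> hx; have /andP[x1 x2] := hx i0.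
  pose y := (Rn_coord x i0 - Rn_coord c i0) / d.
  have y0 : 0 <= y by rewrite divr_ge0 ?subr_ge0// ltW.
  have yE : y * d = Rn_coord x i0 - Rn_coord c i0 by rewrite divfK// gt_eqF.
  have [i /andP[i1 i2]] : exists i : nat, i%:R <= y < i.+1%:R.
    by exists (Num.truncn y); exact: truncn_itv.
  rewrite -bigcup_seq; exists i => /=; last first.
    split => //=; rewrite in_itv /=; apply/andP; split.
      by have := ler_wpM2r (ltW d0) i1; lra.
    by move: i2; rewrite -(ltr_pM2r d0); lra.
  rewrite mem_iota /= add0n -(ltr_nat R); apply: le_lt_trans i1 _.
  by rewrite -(ltr_pM2r d0) -hd yE; lra.
- move=> i.
  have [|mB eB] := @leb_box R n
     (fun j => Rn_coord c j + (if j == i0 then i%:R * d else 0))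
     (fun j => Rn_coord c j + (if j == i0 then i.+1%:R * d else h)).
    move=> j; rewrite lerD2l; case: ifP => _; last exact: ltW.
    by rewrite ler_pM2r// ler_nat.
  apply: (@le_trans _ _ (mu [set x : Rn R n | forall j,
      Rn_coord c j + (if j == i0 then i%:R * d else 0) <= Rn_coord x j <=
      Rn_coord c j + (if j == i0 then i.+1%:R * d else h)])).
    apply: le_measure; rewrite ?inE// => x [hx /=]; rewrite in_itv /= => xi j.
    case: eqVneq => [->|_]; first by case/andP: xi => -> /ltW ->.
    by have /andP[? /ltW ->] := hx j; rewrite addr0 andbT.
  rewrite eB leb_hcube// -EFinM lee_fin le_eqVlt; apply/orP; left; apply/eqP.
  rewrite (eq_bigr (fun j => h * (if j == i0 then N%:R^-1 else 1))); last first.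
    move=> j _; case: ifP => _; last by ring.
    rewrite -addn1 natrD /d; ring.
  rewrite big_split /= prodr_const card_ord mulrC; congr (_ * _).
  by rewrite (bigD1 i0)//= big1 ?mulr1 => // j /negPf ->//.
Qed.

Variables (w v : Rn R n -> R) (beta c1 alpha : R).
Hypotheses (hw : measurable_fun setT w) (w0 : forall x, 0 <= w x).
Hypotheses (hv : measurable_fun setT v) (v0 : forall x, 0 <= v x).
Hypotheses (beta0 : 0 < beta) (c10 : 0 < c1) (alpha01 : 0 < alpha < 1).
Hypothesis hF : forall Q E : set (Rn R n), is_cube Q -> measurable E -> E `<=` Q ->
  (mu E <= alpha%:E * mu Q)%E ->
  (\int[mu]_(x in E) (w x)%:E <=
   (c1 * (fine (mu E) / fine (mu Q)) `^ beta)%:E *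
   \int[mu]_(x in Q `\` E) (v x)%:E)%E.

Lemma measurable_EFin_sub (g : Rn R n -> R) (D : set (Rn R n)) :
  measurable_fun setT g -> measurable D -> measurable_fun D (EFin \o g).
Proof. by move=> mg mD; apply/measurable_EFinP; exact: measurable_funS mg. Qed.

Lemma conditionF_hcube (c : Rn R n) (h rho : R) (E : set (Rn R n)) : 0 < h ->
  measurable E -> E `<=` hcube c h -> 0 <= rho <= alpha ->
  (mu E <= rho%:E * mu (hcube c h))%E ->
  (\int[mu]_(x in E) (w x)%:E <=
   (c1 * rho `^ beta)%:E * \int[mu]_(x in hcube c h `\` E) (v x)%:E)%E.
Proof.
move=> h0 mE EQ /andP[r0 ra] Er; have := leb_hcube c h0; move=> hQ.
have [mc cQ] := leb_cube c (ltW h0).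
have hn0 : 0 < h ^+ n by rewrite exprn_gt0.
have Efin : mu E \is a fin_num.
  by rewrite ge0_fin_numE//; apply: le_lt_trans Er _; rewrite hQ -EFinM ltry.
apply: le_trans (hF _ mE _ _) _.
- by exists c, h.
- by apply: subset_trans EQ _; exact: hcube_sub.
- apply: le_trans Er _; rewrite hQ cQ -!EFinM lee_fin ler_wpM2r// ltW//.
have mQ := measurable_hcube c h.
have -> : (\int[mu]_(x in hcube c h `\` E) (v x)%:E =
           \int[mu]_(x in cube c h `\` E) (v x)%:E)%E.
  apply: ge0_integral_null_diff.
  - exact: measurableD.
  - exact: measurableD.
  - by apply: setSD; exact: hcube_sub.
  - apply/eqP; rewrite eq_le measure_ge0 andbT -(leb_cubeD_hcube c h0).
    apply: le_measure; rewrite ?inE; do ?[exact: measurableD].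
      by do ?apply: measurableD.
    by move=> x [[cx nE] nh]; split => // hx; apply: nh.
  - by apply: measurable_EFin_sub => //; exact: measurableD.
  - by move=> x _; rewrite lee_fin.
rewrite lee_wpmul2r//; first by apply: integral_ge0 => x _; rewrite lee_fin.
rewrite lee_fin ler_wpM2l ?(ltW c10)//.
apply: ge0_ler_powR; rewrite ?nnegrE//; first exact: ltW.
rewrite cQ /= ler_pdivrMr//.
by move: Er; rewrite hQ -(fineK Efin) -EFinM lee_fin.
Qed.

(** Condition F says nothing about the [w]-integral over the whole cube. It applies,
    however, to the union of [U] with each of [N] thin slabs that cover the cube, and
    bounds its [w]-integral by the [v]-integral off [U]. *)
Lemma conditionF_whole (c : Rn R n) (h : R) (U : set (Rn R n)) (N : nat) : 0 < h ->
  (0 < N)%N -> N%:R^-1 <= alpha / 2 -> measurable U -> U `<=` hcube c h ->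
  (mu U <= (alpha / 2)%:E * mu (hcube c h))%E ->
  (\int[mu]_(x in hcube c h) (w x)%:E <=
   (N%:R * c1)%:E * \int[mu]_(x in hcube c h `\` U) (v x)%:E)%E.
Proof.
move=> h0 N0 Na mU UQ Ua; have /andP[a0 a1] := alpha01.
have [F [mF tF FQ Fs]] := slab_cover c h0 N0.
have mQ := measurable_hcube c h.
have iv0 : (0 <= \int[mu]_(x in hcube c h `\` U) (v x)%:E)%E.
  by apply: integral_ge0 => x _; rewrite lee_fin.
rewrite -{1}FQ (ge0_integral_bigsetU mu mF (iota_uniq 0 N)); last 3 first.
- exact: sub_trivIset tF.
- by rewrite FQ; exact: measurable_EFin_sub.
- by move=> x _; rewrite lee_fin.
apply: (@le_trans _ _ (\sum_(i <- iota 0 N)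
    c1%:E * \int[mu]_(x in hcube c h `\` U) (v x)%:E)%E); last first.
  rewrite big_const_seq count_predT size_iota iter_addr addr0.
  by rewrite EFinM -muleA mule_natl.
rewrite big_seq [leRHS]big_seq; apply: lee_sum => i iN.
have FiQ : F i `<=` hcube c h.
  by rewrite -FQ -bigcup_seq => x Fx; exists i.
have mFU : measurable (F i `|` U) by exact: measurableU.
apply: (@le_trans _ _ (\int[mu]_(x in F i `|` U) (w x)%:E)%E).
  apply: (ge0_subset_integral _ (mF i) mFU (measurable_EFin_sub hw mFU)).
    by move=> x _; rewrite lee_fin.
  exact: subsetUl.
have muFU : (mu (F i `|` U) <= alpha%:E * mu (hcube c h))%E.
  apply: le_trans (measureU2 _ (mF i) mU) _.
  rewrite [in leRHS](splitr alpha) EFinD ge0_muleDl; do ?by rewrite lee_fin divr_ge0 ?ltW.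
  apply: leeD => //; apply: le_trans (Fs i) _.
  by rewrite lee_wpmul2r// lee_fin.
apply: le_trans (conditionF_hcube h0 mFU _ _ muFU) _.
- by move=> x [/FiQ|/UQ].
- by rewrite lexx ltW.
have -> : hcube c h `\` (F i `|` U) = (hcube c h `\` U) `\` F i.
  by rewrite setDUr setDE setDE setDE setIACA setIid setIAC setIA.
apply: lee_pmul.
- by rewrite lee_fin mulr_ge0 ?powR_ge0// ltW.
- by apply: integral_ge0 => x _; rewrite lee_fin.
- rewrite lee_fin ler_piMr ?(ltW c10)//.
  by apply: powR_le1; rewrite ?ltW.
- apply: ge0_subset_integral.
  + by do 2?apply: measurableD.
  + exact: measurableD.
  + by apply: measurable_EFin_sub => //; exact: measurableD.
  + by move=> x _; rewrite lee_fin.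
  + exact: subDsetl.
Qed.

(** The powers of [lam] that exceed [alpha] are finitely many; for these [j] the whole
    cube is compared with the complement of [U j0], and the constant absorbs the loss. *)
Lemma conditionF_nested (lam : R) : 0 < lam < 1 -> exists C j0, 0 < C /\
  forall (c : Rn R n) (h : R) (U : nat -> set (Rn R n)), 0 < h ->
    (forall j, measurable (U j)) -> (forall j, U j `<=` hcube c h) ->
    (forall i j, (i <= j)%N -> U j `<=` U i) ->
    (forall j, (mu (U j) <= (lam ^+ j)%:E * mu (hcube c h))%E) ->
    forall j, (\int[mu]_(x in U j) (w x)%:E <= (C * (lam `^ beta) ^+ j)%:E *
      \int[mu]_(x in hcube c h `\` U (j + j0)%N) (v x)%:E)%E.
Proof.
move=> /andP[l0 l1]; have /andP[a0 a1] := alpha01.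
have [j0 Hj0] : exists j0, lam ^+ j0 <= alpha / 2.
  have : (lam ^+ j @[j --> \oo] --> (0:R))%classic by apply: cvg_expr; rewrite ger0_norm// ltW.
  move=> /cvgrPdist_lt /(_ (alpha / 2)) []; first by rewrite divr_gt0.
  move=> j0 _ /(_ j0 (leqnn _)) /=; rewrite sub0r normrN => H; exists j0.
  by apply: le_trans (ltW H); exact: ler_norm.
pose N := (Num.truncn (2 / alpha)).+1.
have N0 : (0 < N)%N by [].
have NR0 : 0 < N%:R :> R by rewrite ltr0n.
have Na : N%:R^-1 <= alpha / 2.
  rewrite -[leRHS]invrK lef_pV2 ?posrE ?invr_gt0 ?divr_gt0// invf_div.
  by apply/ltW; exact: truncnS_gt.
have r0 : 0 < lam `^ beta by exact: powR_gt0.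
have r1 : lam `^ beta <= 1.
  by apply: powR_le1; rewrite ?ltW.
pose r := lam `^ beta.
exists (N%:R * c1 / r ^+ j0), j0; split; first by rewrite !mulr_gt0 ?invr_gt0 ?exprn_gt0.
move=> c h U h0 mU UQ Ud Ul j.
have mQ := measurable_hcube c h.
have iv0 i : (0 <= \int[mu]_(x in hcube c h `\` U i) (v x)%:E)%E.
  by apply: integral_ge0 => x _; rewrite lee_fin.
have ivle i k : (i <= k)%N -> (\int[mu]_(x in hcube c h `\` U i) (v x)%:E <=
    \int[mu]_(x in hcube c h `\` U k) (v x)%:E)%E.
  move=> ik; apply: ge0_subset_integral; do ?exact: measurableD.
  - by apply: measurable_EFin_sub => //; exact: measurableD.
  - by move=> x _; rewrite lee_fin.
  - by apply: setDS; exact: Ud.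
have [jj|jj] := leqP j0 j.
  apply: le_trans (conditionF_hcube h0 (mU j) (UQ j) _ (Ul j)) _.
    rewrite exprn_ge0 ?(ltW l0)//=.
    apply: (@le_trans _ _ (lam ^+ j0)); first by rewrite ler_wiXn2l// ltW.
    by apply: le_trans Hj0 _; rewrite ler_pdivrMr// ler_pMr// ler1n.
  rewrite powR_exprn ?(ltW l0)//.
  apply: lee_pmul => //; first by rewrite lee_fin mulr_ge0 ?exprn_ge0 ?ltW.
    rewrite lee_fin ler_wpM2r ?exprn_ge0 ?(ltW r0)// -mulrA mulrCA ler_pMr//.
    rewrite -[leLHS]mulr1 ler_pM ?ler1n// invf_ge1 ?exprn_gt0//.
    by rewrite exprn_ile1// ltW.
  by apply: ivle; exact: leq_addr.
apply: (@le_trans _ _ (\int[mu]_(x in hcube c h) (w x)%:E)%E).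
  apply: (ge0_subset_integral _ (mU j) mQ (measurable_EFin_sub hw mQ)) (UQ j).
  by move=> x _; rewrite lee_fin.
have Uj0 : (mu (U j0) <= (alpha / 2)%:E * mu (hcube c h))%E.
  by apply: le_trans (Ul j0) _; rewrite lee_wpmul2r// lee_fin.
apply: le_trans (conditionF_whole h0 N0 Na (mU j0) (UQ j0) Uj0) _.
apply: lee_pmul => //; first by rewrite lee_fin mulr_ge0 ?ltW.
  rewrite lee_fin -[leRHS]mulrA ler_pMr ?mulr_gt0//.
  rewrite ler_pdivlMl ?exprn_gt0// mulr1.
  by rewrite ler_wiXn2l ?(ltW r0)// ltnW.
by apply: ivle; exact: leq_addl.
Qed.

End ConditionF.

(** * Medians and oscillation *)

Section Medians.
Variables (R : realType) (n : nat).
Local Notation mu := (leb R n).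

Lemma measurable_superlevel (Q : set (Rn R n)) (g : Rn R n -> R) (c : R) :
  measurable Q -> measurable_fun setT g -> measurable [set z | Q z /\ c < g z].
Proof.
move=> mQ mg; rewrite (_ : [set _ | _] = Q `&` g @^-1` `]c, +oo[).
  by apply: measurableI => //; rewrite -[X in measurable X]setTI; exact: mg.
by apply/seteqP; split => z /=; rewrite in_itv /= andbT.
Qed.

Lemma measurable_sublevel (Q : set (Rn R n)) (g : Rn R n -> R) (c : R) :
  measurable Q -> measurable_fun setT g -> measurable [set z | Q z /\ g z < c].
Proof.
move=> mQ mg; rewrite (_ : [set _ | _] = Q `&` g @^-1` `]-oo, c[).
  by apply: measurableI => //; rewrite -[X in measurable X]setTI; exact: mg.
by apply/seteqP; split => z /=; rewrite in_itv.
Qed.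

Lemma measurable_dist (g : Rn R n -> R) (c : R) :
  measurable_fun setT g -> measurable_fun setT (fun z => `|g z - c|).
Proof.
move=> mg; apply: (measurableT_comp (@normr_measurable R setT)).
exact: (measurable_funB mg (measurable_cst c)).
Qed.

(** For [M > c + a], the set where [f < M] contains all of [Q] but the exceptional set,
    hence more than the proportion [t] of [Q]; for [M = c - a], it is contained in the
    exceptional set, whose proportion is below [1 - t < t]. *)
Lemma median_close (f : Rn R n -> R) (t c a : R) (Q : set (Rn R n)) :
  measurable_fun setT f -> measurable Q -> (0 < mu Q < +oo)%E -> 1 / 2 < t < 1 ->
  (mu [set z | Q z /\ (a < `|f z - c|)%R] < (1 - t)%:E * mu Q)%E ->
  `|median f t Q - c| <= a.
Proof.
move=> mf mQ /andP[Q0 Qoo] /andP[t12 t1] bad.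
have mbad := measurable_superlevel a mQ (measurable_dist c mf).
have Qfin : mu Q \is a fin_num by rewrite ge0_fin_numE.
have q0 : 0 < fine (mu Q) by rewrite fine_gt0// Q0 Qoo.
set S := [set M | (mu [set y | Q y /\ (f y < M)%R] <= t%:E * mu Q)%E].
have S1 : S (c - a).
  apply: (@le_trans _ _ ((1 - t)%:E * mu Q)%E); last first.
    by rewrite lee_wpmul2r// lee_fin; lra.
  apply: le_trans (ltW bad); apply: le_measure; rewrite ?inE//.
    exact: measurable_sublevel.
  move=> z [Qz fz]; split => //; rewrite ltr_normr; apply/orP; right; lra.
have S2 : ubound S (c + a).
  move=> M; rewrite /S /= => HM; rewrite leNgt; apply/negP => cM.
  have mM := measurable_sublevel M mQ mf.
  have : (mu Q <= mu [set z | Q z /\ (a < `|f z - c|)%R] + mu [set y | Q y /\ (f y < M)%R])%E.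
    apply: le_trans (measureU2 _ mbad mM); apply: le_measure; rewrite ?inE//.
      exact: measurableU.
    move=> z Qz; have [fz|fz] := ltP a `|f z - c|; [by left|right; split => //].
    by have := ler_norm (f z - c); lra.
  apply/negP; rewrite -ltNge.
  have -> : mu Q = ((1 - t)%:E * mu Q + t%:E * mu Q)%E.
    by rewrite -(fineK Qfin) -!EFinM -EFinD; congr EFin; ring.
  apply: lte_leD => //; rewrite ge0_fin_numE//; apply: le_lt_trans Qoo.
  by apply: le_measure; rewrite ?inE// => z [].
have S3 : c - a <= sup S by apply: ub_le_sup => //; exists (c + a).
have S4 : sup S <= c + a by apply: ge_sup => //; exists (c - a).
rewrite ler_norml /median -/S; lra.
Qed.

Lemma leb_cube_bounds (a : Rn R n) l : 0 < l -> (0 < mu (cube a l) < +oo)%E.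
Proof.
move=> l0; have [_ ->] := leb_cube a (ltW l0).
by rewrite lte_fin exprn_gt0//= ltry.
Qed.

Lemma is_cube_measurable (Q : set (Rn R n)) : is_cube Q -> measurable Q.
Proof. by move=> [a [l [l0 ->]]]; apply: measurable_cube; exact: ltW. Qed.

Lemma is_cube_bounds (Q : set (Rn R n)) : is_cube Q -> (0 < mu Q < +oo)%E.
Proof. by move=> [a [l [l0 ->]]]; exact: leb_cube_bounds. Qed.

Lemma cube_ext (a b : Rn R n) l : (forall i, Rn_coord a i = Rn_coord b i) ->
  cube a l = cube b l.
Proof. by move=> ab; apply/seteqP; split => x H i; have := H i; rewrite ab. Qed.

Variables (f : Rn R n -> R) (A : set (Rn R n) -> R) (K s t : R).
Hypotheses (mf : measurable_fun setT f) (K0 : 0 < K) (hs : 0 < s).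
Hypotheses (ht : 1 / 2 < t < 1 - s).
Hypothesis Ale : forall Q Q', is_cube Q -> is_cube Q' -> Q `<=` Q' -> A Q' <= A Q.
Hypothesis hosc : forall Q, is_cube Q -> exists c,
  (mu [set z | Q z /\ (K * A Q < `|f z - c|)%R] < s%:E * mu Q)%E.

Let t1 : 1 / 2 < t < 1. Proof. by move: hs ht => ? /andP[? ?]; apply/andP; split; lra. Qed.

Lemma median_deviation Q : is_cube Q ->
  (mu [set z | Q z /\ (2 * K * A Q < `|f z - median f t Q|)%R] < s%:E * mu Q)%E.
Proof.
move=> cQ; have [c hc] := hosc cQ; have mQ := is_cube_measurable cQ.
have mc : `|median f t Q - c| <= K * A Q.
  apply: median_close => //; first exact: is_cube_bounds.
  apply: lt_le_trans hc _; rewrite lee_wpmul2r// lee_fin.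
  by case/andP: ht; lra.
apply: le_lt_trans hc; apply: le_measure; rewrite ?inE.
- exact: measurable_superlevel (measurable_dist _ mf).
- exact: measurable_superlevel (measurable_dist _ mf).
move=> z [Qz fz]; split => //.
have := ler_distD c (f z) (median f t Q); rewrite (distrC c); lra.
Qed.

Lemma median_step Q Q' : is_cube Q -> is_cube Q' -> Q `<=` Q' ->
  (s%:E * mu Q' <= (1 - t)%:E * mu Q)%E ->
  `|median f t Q - median f t Q'| <= 2 * K * A Q.
Proof.
move=> cQ cQ' QQ' small; apply: (@le_trans _ _ (2 * K * A Q')).
  apply: median_close => //; [exact: is_cube_measurable|exact: is_cube_bounds|].
  apply: lt_le_trans small; apply: le_lt_trans (median_deviation cQ').
  apply: le_measure; rewrite ?inE.
  - by apply: measurable_superlevel (measurable_dist _ mf); exact: is_cube_measurable.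
  - by apply: measurable_superlevel (measurable_dist _ mf); exact: is_cube_measurable.
  by move=> z [/QQ' Qz fz].
by rewrite ler_wpM2l ?Ale// mulr_ge0// ltW.
Qed.

(** Passing from a cube directly to one of twice the side would require [s] to be
    small against the ratio [2 ^ n] of the volumes. Interpolating [N] cubes between
    them brings the ratio of consecutive volumes as close to 1 as needed, and all
    of them contain the smallest one. *)
Lemma median_parent (N : nat) (a a' : Rn R n) (h : R) : (0 < N)%N ->
  s <= (1 - t) * (1 - N%:R^-1) ^+ n -> 0 < h ->
  (forall i, Rn_coord a' i <= Rn_coord a i <= Rn_coord a' i + h) ->
  `|median f t (cube a h) - median f t (cube a' (2 * h))| <=
  N%:R * (2 * K * A (cube a h)).
Proof.
move=> N0 sN h0 aa'; have NR0 : 0 < N%:R :> R by rewrite ltr0n.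
have Nn0 : N%:R != 0 :> R by rewrite gt_eqF.
have t10 : 0 < 1 - t by case/andP: t1; lra.
pose th i : R := i%:R / N%:R.
have thS i : th i.+1 = th i + N%:R^-1 by rewrite /th -addn1 natrD mulrDl mul1r.
have th0 i : 0 <= th i by rewrite divr_ge0.
have iN0 : 0 < N%:R^-1 :> R by rewrite invr_gt0.
pose b i : Rn R n :=
  [tuple Rn_coord a j + th i * (Rn_coord a' j - Rn_coord a j) | j < n].
have bE i j : Rn_coord (b i) j =
    Rn_coord a j + th i * (Rn_coord a' j - Rn_coord a j).
  by rewrite /Rn_coord tnth_mktuple.
pose hh i := h + th i * h.
have hh0 i : 0 < hh i by rewrite ltr_wpDr// mulr_ge0// ltW.
pose C i := cube (b i) (hh i).
have cC i : is_cube (C i) by exists (b i), (hh i).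
have CS i : C i `<=` C i.+1.
  move=> x Cx j; have /andP[x1 x2] := Cx j; have /andP[a1 a2] := aa' j.
  move: x1 x2; rewrite /hh !bE thS => x1 x2.
  have : N%:R^-1 * (Rn_coord a' j - Rn_coord a j) <= 0 by rewrite pmulr_rle0// subr_le0.
  have : 0 <= N%:R^-1 * (Rn_coord a' j + h - Rn_coord a j).
    by rewrite mulr_ge0// ?(ltW iN0)// subr_ge0.
  by move=> ? ?; apply/andP; split; nra.
have C0 : C 0%N = cube a h.
  rewrite /C /hh (_ : th 0%N = 0) ?mul0r ?addr0; last by rewrite /th mul0r.
  by apply: cube_ext => j; rewrite bE /th mul0r mul0r addr0.
have CN : C N = cube a' (2 * h).
  rewrite /C /hh (_ : th N = 1) ?mul1r; last by rewrite /th mulfV.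
  rewrite (_ : 2 * h = h + h); last by ring.
  by apply: cube_ext => j; rewrite bE /th mulfV// mul1r; ring.
have CsubS i : C 0%N `<=` C i.
  by elim: i => // i IH; apply: subset_trans IH (CS i).
have step i : `|median f t (C i) - median f t (C i.+1)| <= 2 * K * A (C 0%N).
  apply: le_trans (median_step (cC i) (cC i.+1) (CS i) _) _; last first.
    by rewrite ler_wpM2l ?Ale// mulr_ge0// ltW.
  have [_ ->] := leb_cube (b i) (ltW (hh0 i)).
  have [_ ->] := leb_cube (b i.+1) (ltW (hh0 i.+1)).
  rewrite -!EFinM lee_fin.
  apply: (@le_trans _ _ ((1 - t) * (1 - N%:R^-1) ^+ n * hh i.+1 ^+ n)).
    by rewrite ler_wpM2r// exprn_ge0// ltW.
  rewrite -mulrA -exprMn ler_pM2l// lerXn2r ?nnegrE ?(ltW (hh0 _))//.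
    rewrite mulr_ge0 ?(ltW (hh0 _))// subr_ge0 invf_le1// ler1n//.
  have : 0 <= N%:R^-1 * (th i.+1 * h) by rewrite !mulr_ge0// ltW.
  by rewrite /hh thS; lra.
have tele m : `|median f t (C 0%N) - median f t (C m)| <= m%:R * (2 * K * A (C 0%N)).
  elim: m => [|m IH]; first by rewrite subrr normr0 mul0r.
  apply: le_trans (ler_distD (median f t (C m)) _ _) _.
  by rewrite -addn1 natrD mulrDl mul1r addn1; apply: lerD.
by have := tele N; rewrite C0 CN.
Qed.

End Medians.

Lemma bernoulli_ineq (R : realFieldType) (x : R) n : 0 <= x <= 1 ->
  1 - n%:R * x <= (1 - x) ^+ n.
Proof.
move=> /andP[x0 x1]; elim: n => [|n IH]; first by rewrite mul0r subr0.
have y0 : 0 <= 1 - x by rewrite subr_ge0.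
rewrite exprS; apply: le_trans (ler_wpM2l y0 IH); rewrite -addn1 natrD.
have : 0 <= n%:R * (x * x) by rewrite !mulr_ge0.
lra.
Qed.

Lemma interpolation_steps_exist (R : realType) (s t : R) (n : nat) : t < 1 -> s < 1 - t ->
  exists2 N : nat, (0 < N)%N & s <= (1 - t) * (1 - N%:R^-1) ^+ n.
Proof.
move=> t1 st; have u0 : 0 < 1 - t by lra.
have d0 : 0 < 1 - t - s by lra.
pose N := (Num.truncn (n%:R * (1 - t) / (1 - t - s))).+1.
have NR0 : 0 < N%:R :> R by rewrite ltr0n.
exists N => //.
have := @bernoulli_ineq R N%:R^-1 n.
rewrite invr_ge0 ltW//= invf_le1// ler1n => /(_ isT) B.
apply: le_trans (ler_wpM2l (ltW u0) B).
suff : (1 - t) * (n%:R * N%:R^-1) <= 1 - t - s by lra.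
have := truncnS_gt (n%:R * (1 - t) / (1 - t - s)).
rewrite ltr_pdivrMr// => H.
by rewrite mulrA ler_pdivrMr// mulrC [leRHS]mulrC; exact: ltW.
Qed.

(** * Functions satisfying condition C *)

Section ConditionC.
Variables (R : realType) (Phi : R -> R) (c0 : R).
Hypothesis hPhi : condition_C Phi c0.
Let c := Num.max c0 1.

Lemma Phi_homo x y : 0 <= x -> x <= y -> Phi x <= Phi y.
Proof.
case: hPhi => _ mono _ _ x0 xy; apply: mono => //; rewrite in_itv /= andbT//.
exact: le_trans xy.
Qed.

Lemma Phi_ge0 x : 0 <= x -> 0 <= Phi x.
Proof. by move=> x0; case: (hPhi) => _ _ <- _; exact: Phi_homo. Qed.

Lemma Phi_double x : 0 <= x -> Phi (2 * x) <= c * Phi x.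
Proof.
rewrite le_eqVlt => /orP[/eqP <-|x0].
  by case: hPhi => _ _ P0 _; rewrite mulr0 P0 mulr0.
case: (hPhi) => _ _ _ /(_ _ x0) /le_trans; apply.
by rewrite ler_wpM2r ?Phi_ge0 ?(ltW x0)// le_max lexx.
Qed.

Lemma doubling_ge1 : 1 <= c. Proof. by rewrite le_max lexx orbT. Qed.

Lemma doubling_ge0 : 0 <= c. Proof. exact: le_trans ler01 doubling_ge1. Qed.

Lemma Phi_scale kappa x : 0 <= x -> Phi (2 ^+ kappa * x) <= c ^+ kappa * Phi x.
Proof.
move=> x0; elim: kappa => [|k IH]; first by rewrite !mul1r.
rewrite !exprS -!mulrA; apply: le_trans (Phi_double _) _.
  by rewrite mulr_ge0// exprn_ge0.
by rewrite ler_wpM2l// doubling_ge0.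
Qed.

Lemma PhiD x y : 0 <= x -> 0 <= y -> Phi (x + y) <= c * (Phi x + Phi y).
Proof.
have W a b : 0 <= a -> 0 <= b -> a <= b -> Phi (a + b) <= c * (Phi a + Phi b).
  move=> a0 b0 ab; apply: (@le_trans _ _ (Phi (2 * b))).
    by apply: Phi_homo; [exact: addr_ge0|lra].
  apply: le_trans (Phi_double b0) _.
  by rewrite ler_wpM2l ?doubling_ge0// lerDr Phi_ge0.
move=> x0 y0; have [xy|/ltW yx] := leP x y; first exact: W.
by rewrite addrC [X in _ * X]addrC; exact: W.
Qed.

(** The terms are split off from the last one: each step towards the first term
    costs a factor [c], whence the powers decreasing in [i]. *)
Lemma Phi_sum k (a : nat -> R) : (forall i, 0 <= a i) ->
  Phi (\sum_(i < k.+1) a i) <= c * \sum_(i < k.+1) c ^+ (k - i) * Phi (a i).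
Proof.
move=> a0; elim: k => [|k IH].
  rewrite !big_ord_recl !big_ord0 !addr0 subnn mul1r.
  by rewrite ler_peMl ?doubling_ge1// Phi_ge0.
rewrite big_ord_recr /=; apply: le_trans (PhiD _ _) _ => //; first exact: sumr_ge0.
rewrite ler_wpM2l ?doubling_ge0// [leRHS]big_ord_recr /= subnn mul1r lerD2r.
apply: le_trans IH _; rewrite mulr_sumr le_eqVlt; apply/orP; left; apply/eqP.
apply: eq_bigr => i _; rewrite mulrA -exprS subSn//.
by rewrite -ltnS.
Qed.

Lemma measurable_Phi_comp d (T : measurableType d) (g : T -> R) :
  measurable_fun setT g -> (forall x, 0 <= g x) ->
  measurable_fun setT (fun x => Phi (g x)).
Proof.
move=> mg g0; pose Psi x := Phi (Num.max x 0).
have -> : (fun x => Phi (g x)) = Psi \o g.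
  by apply/funext => x; rewrite /Psi /= max_l.
apply: measurableT_comp => //; apply: nondecreasing_measurable => // x y xy.
by apply: Phi_homo; [rewrite le_max lexx orbT|rewrite ge_max !le_max xy lexx orbT].
Qed.

End ConditionC.

(** * Stopping cubes *)

Section Stopping.
Variables (R : realType) (n : nat) (a : Rn R n) (l : R).
Hypothesis l0 : 0 < l.
Local Notation mu := (leb R n).
Local Notation code := (grid_code a l).
Local Notation corner := (grid_corner a l).
Local Notation side := (grid_side l).

(** A single number, so that the dyadic cells of all levels form one sequence. *)
Definition dyadic_index k x : nat := pickle (k, code k x).

Definition level (Q : nat) : nat := (odflt (0, 0)%N (unpickle Q)).1.

Definition dcell (Q : nat) : set (Rn R n) :=
  [set x | code (level Q) x = (odflt (0, 0)%N (unpickle Q)).2].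

Definition closed_cube k x := cube (corner k x) (side k).

(** The closed cube of the cell [Q], read off any point of [Q]. *)
Definition dcube (Q : nat) : set (Rn R n) := closed_cube (level Q) (xget point (dcell Q)).

Lemma level_index k x : level (dyadic_index k x) = k.
Proof. by rewrite /level /dyadic_index pickleK. Qed.

Lemma dcell_index k x : dcell (dyadic_index k x) = [set y | code k y = code k x].
Proof. by rewrite /dcell level_index /dyadic_index pickleK. Qed.

Lemma dyadic_index_eq k x y : code k x = code k y -> dyadic_index k x = dyadic_index k y.
Proof. by rewrite /dyadic_index => ->. Qed.

Lemma dcell_self k x : dcell (dyadic_index k x) x.
Proof. by rewrite dcell_index. Qed.

Lemma measurable_dcell Q : measurable (dcell Q).
Proof. exact: measurable_grid_code. Qed.

Lemma corner_eq k x y : code k x = code k y -> corner k x = corner k y.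
Proof.
move=> /grid_code_eqP H; apply: eq_from_tnth => i.
have := grid_cornerE a l k x i; have := grid_cornerE a l k y i.
by rewrite /Rn_coord H => -> ->.
Qed.

Lemma is_cube_closed k x : is_cube (closed_cube k x).
Proof. by exists (corner k x), (side k); split => //; exact: grid_side_gt0. Qed.

Lemma is_cube_dcube Q : is_cube (dcube Q).
Proof. exact: is_cube_closed. Qed.

Lemma dcube_closed Q x : dcell Q x -> dcube Q = closed_cube (level Q) x.
Proof.
move=> Qx; rewrite /dcube /closed_cube; congr (cube _ _); apply: corner_eq.
exact: etrans (xgetI point Qx) (esym Qx).
Qed.

Lemma dcell_hcube Q x : dcell Q x -> dcell Q = hcube (corner (level Q) x) (side (level Q)).
Proof. by move=> Qx; rewrite -grid_code_hcube// /dcell; move: Qx => /= <-. Qed.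

Lemma dcell_sub_dcube Q : dcell Q `<=` dcube Q.
Proof.
by move=> x Qx; rewrite (dcube_closed Qx); apply: hcube_sub; rewrite -dcell_hcube.
Qed.

Lemma leb_dcubeI Q (B : set (Rn R n)) : dcell Q !=set0 -> measurable B ->
  mu (dcube Q `&` B) = mu (dcell Q `&` B).
Proof.
move=> [x Qx] mB; have mQ := is_cube_measurable (is_cube_dcube Q).
have mc := measurable_dcell Q.
apply/eqP; rewrite eq_le; apply/andP; split; last first.
  apply: le_measure; rewrite ?inE; [exact: measurableI|exact: measurableI|].
  by apply: setSI; exact: dcell_sub_dcube.
have null : mu (dcube Q `\` dcell Q) = 0%E.
  by rewrite (dcube_closed Qx) (dcell_hcube Qx) leb_cubeD_hcube// grid_side_gt0.
have mN : measurable (dcube Q `\` dcell Q) by exact: measurableD.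
rewrite -[leRHS]adde0 -null.
apply: le_trans (measureU2 _ (measurableI _ _ mc mB) mN).
apply: le_measure; rewrite ?inE; [exact: measurableI| |].
  by apply: measurableU => //; exact: measurableI.
move=> y [Qy By]; have [Qy'|Qy'] := pselect (dcell Q y); by [left|right].
Qed.

Lemma leb_dcube Q : dcell Q !=set0 -> mu (dcube Q) = mu (dcell Q).
Proof. by move=> Q0; have := leb_dcubeI Q0 measurableT; rewrite !setIT. Qed.

Lemma leb_dcell_lty Q : (mu (dcell Q) < +oo)%E.
Proof. exact: leb_grid_code_lty. Qed.

Variables (f : Rn R n -> R) (A : set (Rn R n) -> R) (K s t : R) (N : nat).
Hypotheses (mf : measurable_fun setT f) (K0 : 0 < K) (hs : 0 < s).
Hypotheses (ht : 1 / 2 < t < 1 - s) (N0 : (0 < N)%N).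
Hypothesis hN : s <= (1 - t) * (1 - N%:R^-1) ^+ n.
Hypothesis A0 : forall Q, 0 <= A Q.
Hypothesis Ale : forall Q Q', is_cube Q -> is_cube Q' -> Q `<=` Q' -> A Q' <= A Q.
Hypothesis hosc : forall Q, is_cube Q -> exists c,
  (mu [set z | Q z /\ (K * A Q < `|f z - c|)%R] < s%:E * mu Q)%E.

Let t01 : 1 / 2 < t < 1.
Proof. by move: hs ht => ? /andP[? ?]; apply/andP; split; lra. Qed.
Let t10 : 0 < 1 - t. Proof. by case/andP: t01; lra. Qed.
Let st : s < 1 - t. Proof. by case/andP: ht; lra. Qed.

Definition med Q := median f t (dcube Q).

Definition far Q : set (Rn R n) := [set z | 2 * K * A (dcube Q) < `|f z - med Q|].

Definition stop Q P := ((1 - t)%:E * mu (dcell P) <= mu (dcell P `&` far Q))%E.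

(** Maximality of [P] among the proper dyadic subcubes satisfying [stop Q] is what the
    last clause says. *)
Definition stop_child Q P := [/\ (level Q < level P)%N,
  exists2 x, dcell Q x & P = dyadic_index (level P) x, stop Q P &
  forall k x, dcell P x -> (level Q < k < level P)%N -> ~ stop Q (dyadic_index k x)].

Lemma measurable_far Q : measurable (far Q).
Proof.
have := measurable_superlevel (2 * K * A (dcube Q)) measurableT (measurable_dist (med Q) mf).
by rewrite (_ : [set z | _ /\ _] = far Q)//; apply/seteqP; split => z //= [].
Qed.

Lemma leb_far Q : dcell Q !=set0 -> (mu (dcell Q `&` far Q) < s%:E * mu (dcell Q))%E.
Proof.
move=> Q0; rewrite -leb_dcubeI//; last exact: measurable_far.
by rewrite -leb_dcube//; exact: (median_deviation mf hs ht hosc (is_cube_dcube Q)).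
Qed.

Lemma dcell_child Q P : stop_child Q P -> exists2 x, dcell Q x &
  dcell P = [set y | code (level P) y = code (level P) x].
Proof. by move=> [_ [x Qx E] _ _]; exists x => //; rewrite E dcell_index level_index. Qed.

Lemma stop_child_sub Q P : stop_child Q P -> dcell P `<=` dcell Q.
Proof.
move=> c; have [QP _ _ _] := c; have [x Qx ->] := dcell_child c.
by move=> y /(grid_code_coarser l0 (ltnW QP)) yx; exact: etrans yx Qx.
Qed.

Lemma stop_child_index Q P y : stop_child Q P -> dcell P y -> P = dyadic_index (level P) y.
Proof.
move=> c Py; have [_ [x Qx E] _ _] := c; rewrite {1}E; apply: dyadic_index_eq.
by move: Py; rewrite E dcell_index level_index => ->.
Qed.

Lemma stop_child_uniq Q P P' x : stop_child Q P -> stop_child Q P' ->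
  dcell P x -> dcell P' x -> P = P'.
Proof.
wlog PP : P P' / (level P <= level P')%N.
  move=> W c c' Px Px'; have [h|/ltnW h] := leqP (level P) (level P'); first exact: W.
  by apply/esym; exact: W.
move=> c c' Px Px'; move: PP; rewrite leq_eqVlt => /orP[/eqP E|lt].
  by rewrite (stop_child_index c Px) (stop_child_index c' Px') E.
have [_ _ _ /(_ (level P) x Px') H] := c'; exfalso; apply: H.
  by rewrite lt andbT; case: c.
by rewrite -(stop_child_index c Px); case: c.
Qed.

Lemma stop_child_exists Q k y : dcell Q y -> (level Q < k)%N ->
  stop Q (dyadic_index k y) -> exists2 P, stop_child Q P & dcell P y.
Proof.
move=> Qy Qk sk; pose p m := (level Q < m)%N && `[< stop Q (dyadic_index m y) >].
have ep : exists m, p m by exists k; rewrite /p Qk; exact/asboolP.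
case: (ex_minnP ep) => m /andP[Qm /asboolP sm] mmin.
exists (dyadic_index m y); last exact: dcell_self.
split; rewrite ?level_index//; first by exists y.
move=> j x; rewrite dcell_index => /= xy /andP[Qj jm] sj.
have /mmin : p j.
  rewrite /p Qj; apply/asboolP; rewrite (@dyadic_index_eq j y x)//.
  by apply/esym; exact: (grid_code_coarser l0 (ltnW jm)).
by rewrite leqNgt jm.
Qed.

Local Notation layer := (layer dcell stop_child).

Lemma layer1E Q : layer Q 1 = \bigcup_(P in stop_child Q) dcell P.
Proof.
rewrite /layer; congr (bigcup _ _); apply/seteqP; split => P /=.
  by move=> [P' ->].
by exists Q.
Qed.

(** The stopping cubes are disjoint, and each has a proportion at least [1 - t] of its
    measure inside the far set of [Q]. *)
Lemma leb_layer1 Q : (mu (layer Q 1) <= (s / (1 - t))%:E * mu (dcell Q))%E.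
Proof.
have [Q0|nQ0] := pselect (dcell Q !=set0); last first.
  rewrite (_ : layer Q 1 = set0) ?measure0 ?mule_ge0// ?lee_fin ?divr_ge0// ?ltW//.
  apply/seteqP; split => // x; rewrite layer1E => -[P c Px].
  by apply: nQ0; exists x; exact: stop_child_sub c _ Px.
have tD : trivIset (stop_child Q) dcell.
  by move=> P P' DP DP' [x [Px P'x]]; exact: stop_child_uniq DP DP' Px P'x.
have tD' : trivIset (stop_child Q) (fun P => dcell P `&` far Q).
  by move=> P P' DP DP' [x [[Px _] [P'x _]]]; exact: stop_child_uniq DP DP' Px P'x.
have mI P : measurable (dcell P `&` far Q).
  by apply: measurableI; [exact: measurable_dcell|exact: measurable_far].
suff H : ((1 - t)%:E * mu (layer Q 1) <= mu (dcell Q `&` far Q))%E.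
  have := le_trans H (ltW (leb_far Q0)); rewrite -lee_pdivlMl//.
  by rewrite muleA -EFinM mulrC.
rewrite layer1E measure_bigcup//; last by move=> *; exact: measurable_dcell.
rewrite -nneseriesZl; last by move=> P _; exact: measure_ge0.
apply: (@le_trans _ _ (\sum_(0 <= P <oo | P \in (stop_child Q : set nat))
    mu (dcell P `&` far Q))%E).
  apply: lee_nneseries => [P _ _|P /set_mem [_ _ sP _]]; last exact: sP.
  by rewrite mule_ge0// lee_fin ltW.
rewrite -measure_bigcup//; apply: le_measure; rewrite ?inE.
- exact: bigcup_measurable.
- exact: mI.
- by move=> x [P c [Px fx]]; split => //; exact: stop_child_sub c _ Px.
Qed.

(** The part of the far set of [Q] off the stopping cubes has density at most [1 - t]
    in every dyadic cube inside [Q]. *)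
Lemma leb_far_uncovered Q : mu (dcell Q `&` far Q `\` layer Q 1) = 0%E.
Proof.
have mL : measurable (layer Q 1) by apply: layer_measurable; exact: measurable_dcell.
have mF : measurable (dcell Q `&` far Q).
  by apply: measurableI; [exact: measurable_dcell|exact: measurable_far].
have mE : measurable (dcell Q `&` far Q `\` layer Q 1) by exact: measurableD.
apply: (@grid_density_null R n a l l0 (level Q)
  (odflt (0, 0)%N (unpickle Q)).2 _ (1 - t)) => //.
- by move=> x [[]].
- by apply/andP; split; case/andP: t01; lra.
move=> k x Qk Qx; have {}Qx : dcell Q x by [].
have mC : measurable [set y | code k y = code k x] by exact: measurable_grid_code.
have QC : [set y | code k y = code k x] `<=` dcell Q.
  by move=> y /(grid_code_coarser l0 Qk) yx; exact: etrans yx Qx.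
move: Qk; rewrite leq_eqVlt => /orP[/eqP Ek|Qk].
  have -> : [set y | code k y = code k x] = dcell Q.
    by apply/seteqP; split => // y Qy; rewrite /= -Ek; exact: etrans Qy (esym Qx).
  apply: (@le_trans _ _ (mu (dcell Q `&` far Q))).
    apply: le_measure; rewrite ?inE//.
      by apply: measurableI => //; exact: measurable_dcell.
    by move=> y [[]].
  apply: le_trans (ltW (leb_far _)) _; first by exists x.
  by rewrite lee_wpmul2r// lee_fin ltW.
have [sx|nsx] := pselect (stop Q (dyadic_index k x)).
  rewrite [X in (mu X <= _)%E](_ : _ = set0) ?measure0 ?mule_ge0// ?lee_fin ?ltW//.
  apply/seteqP; split => // y [[[Qy _] nL] yx]; apply: nL; rewrite layer1E.
  have [|P c Py] := @stop_child_exists Q k y Qy Qk; last by exists P.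
  by rewrite (@dyadic_index_eq k y x).
move/negP: nsx; rewrite -ltNge dcell_index => h.
apply: le_trans (ltW h); apply: le_measure; rewrite ?inE.
- exact: measurableI.
- by apply: measurableI => //; exact: measurable_far.
- by move=> y [[[_ fy] _] Cy].
Qed.

(** The dyadic parent of [P] is [Q] or violates the stopping condition; either way the
    far set has density less than [1 - t] in it, and its median is close to that of
    [Q]. *)
Lemma med_stop_child Q P : stop_child Q P -> dcell P !=set0 ->
  `|med P - med Q| <= 2 * K * N%:R * (A (dcube Q) + A (dcube P)).
Proof.
move=> c [x Px]; have [QP _ _ Pmax] := c; have Qx := stop_child_sub c Px.
have NR1 : 1 <= N%:R :> R by rewrite ler1n.
have K2 : 0 < 2 * K by rewrite mulr_gt0.
case EP : (level P) QP Pmax => [//|k]; rewrite ltnS => Qk Pmax.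
pose P' := dyadic_index k x; have P'x : dcell P' x := dcell_self k x.
have P'0 : dcell P' !=set0 by exists x.
have P'Q : dcell P' `<=` dcell Q.
  by rewrite dcell_index => y /(grid_code_coarser l0 Qk) yx; exact: etrans yx Qx.
have mP' := measurable_dcell P'.
have h1 : `|med P' - med Q| <= 2 * K * A (dcube Q).
  apply: median_close => //.
  - exact: is_cube_measurable (is_cube_dcube P').
  - exact: is_cube_bounds (is_cube_dcube P').
  rewrite [X in (mu X < _)%E](_ : _ = dcube P' `&` far Q)//.
  rewrite leb_dcubeI// ?leb_dcube//; last exact: measurable_far.
  move: Qk; rewrite leq_eqVlt => /orP[/eqP Ek|Qk].
    have P'E : dcell P' = dcell Q.
      apply/seteqP; split => //; rewrite dcell_index => y Qy.
      by rewrite /= -Ek; exact: etrans Qy (esym Qx).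
    rewrite P'E; apply: lt_le_trans (leb_far _) _; first by exists x.
    by rewrite lee_wpmul2r// lee_fin ltW.
  have /negP : ~ stop Q P' by apply: Pmax => //; rewrite Qk ltnSn.
  by rewrite -ltNge.
have h2 : `|med P - med P'| <= N%:R * (2 * K * A (dcube P)).
  rewrite /med (dcube_closed Px) (dcube_closed P'x) EP level_index /closed_cube.
  have -> : side k = 2 * side k.+1.
    by rewrite /grid_side exprS; field; rewrite expf_neq0.
  apply: (median_parent mf K0 hs ht Ale hosc N0 hN); first exact: grid_side_gt0.
  move=> i; rewrite !grid_cornerE rel_coordS//.
  have [b ->] := floor_double (rel_coord a l k x i).
  have -> : side k = 2 * side k.+1.
    by rewrite /grid_side exprS; field; rewrite expf_neq0.
  have s0 := grid_side_gt0 l0 k.+1.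
  rewrite intrD intrM /=; case: b; rewrite ?mulr1z ?mulr0z; nra.
have -> : med P - med Q = (med P - med P') + (med P' - med Q) by ring.
apply: le_trans (ler_normD _ _) _; apply: le_trans (lerD h2 h1) _.
rewrite mulrDr addrC; apply: lerD; last by rewrite le_eqVlt; apply/orP; left; apply/eqP; ring.
by rewrite ler_wpM2r// ler_peMr// ltW.
Qed.

Lemma med_path (q : nat -> nat) k : (forall i, (i < k)%N -> stop_child (q i) (q i.+1)) ->
  dcell (q k) !=set0 ->
  `|med (q k) - med (q 0%N)| <=
  2 * K * N%:R * (2 * (\sum_(i < k) A (dcube (q i))) + A (dcube (q k))).
Proof.
have KN : 0 <= 2 * K * N%:R by rewrite !mulr_ge0// ltW.
elim: k => [|k IH] qc qk; first by rewrite subrr normr0 mulr_ge0// big_ord0 mulr0 add0r.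
have c := qc k (ltnSn k).
have qk0 : dcell (q k) !=set0 by case: qk => x /(stop_child_sub c) qx; exists x.
have {}IH := IH (fun i ik => qc i (ltnW ik)) qk0.
have -> : med (q k.+1) - med (q 0%N) =
  (med (q k.+1) - med (q k)) + (med (q k) - med (q 0%N)) by rewrite addrA subrK.
apply: le_trans (ler_normD _ _) _; apply: le_trans (lerD (med_stop_child c qk) IH) _.
rewrite -mulrDr ler_wpM2l// big_ord_recr /=; lra.
Qed.

(** The median differences telescope along the stopping cubes containing [x]. The
    exceptional points are those in infinitely many generations and those in the far set
    of the last cube. *)
Lemma stopping_representation q0 : dcell q0 !=set0 ->
  \forall x \ae mu, dcell q0 x -> exists k, exists q : nat -> nat,
    [/\ q 0%N = q0, dcell (q k) x, forall i, (i < k)%N -> stop_child (q i) (q i.+1) &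
    `|f x - med q0| <= 4 * K * N%:R * \sum_(i < k.+1) A (dcube (q i))].
Proof.
move=> [x0 q0x].
have NR1 : 1 <= N%:R :> R by rewrite ler1n.
have l01 : 0 <= s / (1 - t) < 1.
  by rewrite divr_ge0 ?(ltW hs) ?(ltW t10)//= ltr_pdivrMr// mul1r.
have nI : mu.-negligible (\bigcap_j layer q0 j).
  apply/negligibleP.
    by apply: bigcapT_measurable => j; apply: layer_measurable measurable_dcell _ _.
  apply: (layer_limit_null measurable_dcell stop_child_sub stop_child_uniq l01).
    by move=> Q; exact: leb_layer1.
  exact: leb_dcell_lty.
have nE : mu.-negligible (\bigcup_Q (dcell Q `&` far Q `\` layer Q 1)).
  apply: negligible_bigcup => Q; apply/negligibleP; last exact: leb_far_uncovered.
  apply: measurableD; last by apply: layer_measurable; exact: measurable_dcell.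
  by apply: measurableI; [exact: measurable_dcell|exact: measurable_far].
apply: negligibleS (negligibleU nI nE) => x /= /not_implyP[q0x' noq].
apply: contrapT => /not_orP[nIx nEx]; apply: noq.
have [j lj nlj] : exists2 j, layer q0 j x & ~ layer q0 j.+1 x.
  apply: contrapT => no; apply: nIx => j _; elim: j => [|j IH].
    by rewrite (layer0 dcell stop_child).
  by apply: contrapT => nj; apply: no; exists j.
case: lj => P dP Px; have [q [q00 qk qc]] := desc_path dP.
exists j, q; rewrite qk; split => //.
have nP : ~ layer P 1 x.
  by move=> lP; apply: nlj; rewrite -addn1 layerD; exists P.
have fx : `|f x - med P| <= 2 * K * A (dcube P).
  rewrite leNgt; apply/negP => farx; apply: nEx; exists P => //.
have qj0 : dcell (q j) !=set0 by exists x; rewrite qk.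
have := med_path qc qj0; rewrite q00 qk => mP.
have -> : f x - med q0 = (f x - med P) + (med P - med q0) by ring.
apply: le_trans (ler_normD _ _) _; apply: le_trans (lerD fx mP) _.
rewrite big_ord_recr /= qk.
have : 2 * K * A (dcube P) <= 2 * K * N%:R * A (dcube P).
  by rewrite ler_wpM2r// ler_peMr// mulr_ge0// ltW.
lra.
Qed.

End Stopping.

(** * Oscillation estimate from the splitting property *)

Section Splitting.
Variables (R : realType) (n : nat).
Local Notation mu := (leb R n).
Variables (X : topologicalLmodType R) (T : {linear X -> (Rn R n -> R^o)}).
Hypothesis mT : forall f, measurable_fun setT (T f : Rn R n -> R).
Variable MT : X -> Rn R n -> R.
Hypothesis MT_ge0 : forall f x, 0 <= MT f x.

Definition inf_on f (Q : set (Rn R n)) : R := inf [set MT f y | y in Q].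

Lemma inf_on_ge0 f Q : 0 <= inf_on f Q.
Proof.
rewrite /inf_on; have [->|/set0P[y Qy]] := eqVneq [set MT f y | y in Q] set0.
  by rewrite inf0.
by apply: lb_le_inf; [exists y|move=> _ [z _ <-]].
Qed.

Lemma inf_on_le f (Q : set (Rn R n)) y : Q y -> inf_on f Q <= MT f y.
Proof. by move=> Qy; apply: ge_inf; [exists 0 => _ [z _ <-]|exists y]. Qed.

Lemma is_cube_nonempty (Q : set (Rn R n)) : is_cube Q -> Q !=set0.
Proof. by move=> [a [l [l0 ->]]]; exists a => i; rewrite lexx lerDl ltW. Qed.

Lemma inf_on_anti f (Q Q' : set (Rn R n)) : is_cube Q -> is_cube Q' -> Q `<=` Q' ->
  inf_on f Q' <= inf_on f Q.
Proof.
move=> /is_cube_nonempty[y Qy] _ QQ'; apply: lb_le_inf; first by exists (MT f y), y.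
by move=> _ [z Qz <-]; apply: inf_on_le; exact: QQ'.
Qed.

(** Where [g1] is small, [g] is close to the constant [g2 x0] up to a null set. *)
Lemma oscillation_split (g g1 g2 : Rn R n -> R) (Q : set (Rn R n)) (x0 : Rn R n)
    (c1 c2 m s : R) :
  measurable_fun setT g -> measurable_fun setT g1 -> is_cube Q ->
  (forall z, g z = g1 z + g2 z) ->
  (mu [set z | Q z /\ (c1 * m < `|g1 z|)%R] < s%:E * mu Q)%E ->
  (Linfty_norm Q (fun z => g2 z - g2 x0)%R <= (c2 * m)%:E)%E ->
  (mu [set z | Q z /\ ((c1 + c2) * m < `|g z - g2 x0|)%R] < s%:E * mu Q)%E.
Proof.
move=> mg mg1 cQ gE h1 h2; have mQ := is_cube_measurable cQ.
have muT : (0 < mu setT)%E.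
  have /andP[Q0 _] := is_cube_bounds cQ; apply: lt_le_trans Q0 _.
  by apply: le_measure; rewrite ?inE.
move: h2; rewrite /Linfty_norm unlock /= muT => /ess_supP [N [mN N0 NP]].
apply: le_lt_trans h1.
have m1 : measurable [set z | Q z /\ (c1 * m < `|g1 z|)%R].
  have mn : measurable_fun setT (fun z => `|g1 z|).
    exact: (measurableT_comp (@normr_measurable R setT) mg1).
  exact: (measurable_superlevel _ mQ mn).
rewrite -[leRHS]adde0 -[X in (_ <= _ + X)%E]N0.
apply: le_trans (measureU2 _ m1 mN); apply: le_measure; rewrite ?inE.
- exact: measurable_superlevel (measurable_dist _ mg).
- exact: measurableU.
move=> z [Qz fz]; have [Nz|nN] := pselect (N z); [by right|left; split => //].
have : `|g2 z - g2 x0| <= c2 * m.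
  rewrite leNgt; apply/negP => h; apply: nN; apply: NP => /=.
  by rewrite patchE mem_set//= lee_fin; apply/negP; rewrite -ltNge.
have := ler_normD (g1 z) (g2 z - g2 x0).
by move: fz; rewrite gE mulrDl addrA; lra.
Qed.

Lemma splitting_oscillation (s : R) (S : set X) : splitting_property T MT s S ->
  exists2 K, 0 < K & forall f, S f -> forall Q, is_cube Q -> exists c : R,
    (mu [set z | Q z /\ (K * inf_on f Q < `|T f z - c|)%R] < s%:E * mu Q)%E.
Proof.
move=> [_ [c1 [c2 [c10 c20 H]]]]; exists (c1 + c2); first exact: addr_gt0.
move=> f Sf Q cQ; have [xQ QxQ /(_ f Sf) [f1 [f2 [fE h1 h2]]]] :=
  H Q Q cQ cQ (@subset_refl _ Q).
exists (T f2 xQ : R); apply: (oscillation_split (mT f) (mT f1) cQ _ h1 h2) => z.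
by rewrite fE linearD.
Qed.

End Splitting.

(** * The local estimate *)

Section Local.
Variables (R : realType) (n : nat).
Local Notation mu := (leb R n).

Lemma grid_corner0 (a : Rn R n) l : 0 < l -> closed_cube a l 0 a = cube a l.
Proof.
move=> l0; rewrite /closed_cube /grid_side expr0 divr1; apply: cube_ext => i.
by rewrite grid_cornerE /rel_coord subrr mul0r floor0 mul0r addr0.
Qed.

Lemma dcell_root (a : Rn R n) l : 0 < l -> dcell a l (dyadic_index a l 0 a) = hcube a l.
Proof.
move=> l0; rewrite dcell_index grid_code_hcube//.
rewrite /grid_side expr0 divr1; apply/seteqP; split => x H i; have := H i;
by rewrite grid_cornerE /rel_coord subrr mul0r floor0 mul0r addr0.
Qed.

Variables (Phi : R -> R) (c0 : R) (w v : Rn R n -> R) (beta s t K : R).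
Hypotheses (n_gt0 : (0 < n)%N) (hPhi : condition_C Phi c0).
Hypotheses (hw : weight w) (hv : weight v) (hF : condition_F w v beta).
Hypotheses (hs : 0 < s) (ht : 1 / 2 < t < 1 - s).
Hypothesis hst : c0 * (s / (1 - t)) `^ beta < 1.
Hypothesis K0 : 0 < K.

(** [g] and [A] stand for [MT f] and its infimum over sets; the constant is found
    before the cube and the functions are given. *)
Theorem median_integral_le : exists2 c, 0 < c & forall (a : Rn R n) (l : R)
    (f g : Rn R n -> R) (A : set (Rn R n) -> R), 0 < l -> measurable_fun setT f ->
    (forall x, 0 <= g x) -> (forall Q, 0 <= A Q) ->
    (forall Q x, Q x -> A Q <= g x) ->
    (forall Q Q', is_cube Q -> is_cube Q' -> Q `<=` Q' -> A Q' <= A Q) ->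
    (forall Q, is_cube Q -> exists c,
      (mu [set z | Q z /\ (K * A Q < `|f z - c|)%R] < s%:E * mu Q)%E) ->
  (\int[mu]_(x in cube a l) (Phi `|f x - median f t (cube a l)| * w x)%:E
   <= c%:E * \int[mu]_(x in cube a l) (Phi (g x) * v x)%:E)%E.
Proof.
have [mw w0 _] := hw; have [mv v0 _] := hv.
have [beta0 [c1 [alpha [c10 al hFQ]]]] := hF.
have t1 : t < 1 by case/andP: ht; move: hs; lra.
have t10 : 0 < 1 - t by lra.
have st : s < 1 - t by case/andP: ht; lra.
pose lam := s / (1 - t).
have lam01 : 0 < lam < 1 by rewrite divr_gt0//= ltr_pdivrMr// mul1r.
have /andP[lam0 lam1] := lam01.
have [N N0 hN] := interpolation_steps_exist n t1 st.
have [C [j0 [C0 HC]]] := conditionF_nested n_gt0 mw w0 mv v0 beta0 c10 al hFQ lam01.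
pose c := Num.max c0 1; pose r := lam `^ beta.
have c_ge0 : 0 <= c := doubling_ge0 c0.
have r0 : 0 <= r by exact: powR_ge0.
have r1 : r < 1.
  have -> : 1 = 1 `^ beta :> R by rewrite powR1.
  by apply: gt0_ltr_powR; rewrite ?nnegrE ?ltW.
have cr : 0 <= c * r < 1.
  rewrite mulr_ge0//= /c maxEle; case: ifP => _; first by rewrite mul1r.
  exact: hst.
pose S := j0%:R / (1 - c * r) + c * r / (1 - c * r) ^+ 2.
have S0 : 0 <= S.
  have /andP[cr0 cr1] := cr; have y0 : 0 < 1 - c * r by rewrite subr_gt0.
  by rewrite addr_ge0 ?divr_ge0 ?exprn_ge0// ltW.
(* [2 ^ kap] dominates the constant of the stopping representation. *)
pose kap := Num.bound (4 * K * N%:R).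
have Kkap : 4 * K * N%:R <= 2 ^+ kap.
  apply: (@le_trans _ _ kap%:R).
    by apply/ltW/archi_boundP; rewrite !mulr_ge0// ltW.
  by rewrite -natrX ler_nat ltnW// ltn_expl.
pose M := c ^+ kap * c.
have M0 : 0 < M.
  by rewrite mulr_gt0 ?exprn_gt0//; exact: lt_le_trans ltr01 (doubling_ge1 c0).
exists (M * (C * S) + 1).
  by rewrite ltr_wpDl// (mulr_ge0 (ltW M0))// mulr_ge0// ltW.
move=> a l f g A l0 mf g0 A0 Ag Ale hosc.
pose q0 := dyadic_index a l 0 a.
have q0E : dcell a l q0 = hcube a l := dcell_root a l0.
have q0a : dcell a l q0 a by exact: dcell_self.
have cubeE : dcube a l q0 = cube a l.
  by rewrite (dcube_closed q0a) level_index grid_corner0.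
pose m := median f t (cube a l).
pose F x := Phi `|f x - m| * w x; pose H x := Phi (g x) * v x.
have mF : measurable_fun setT F.
  apply: (measurable_funM _ mw).
  exact: (measurable_Phi_comp hPhi (measurable_dist m mf) (fun x => normr_ge0 _)).
have F0 x : 0 <= F x by rewrite mulr_ge0// (Phi_ge0 hPhi).
have H0 x : 0 <= H x by rewrite mulr_ge0// (Phi_ge0 hPhi).
pose cell := dcell a l; pose child := stop_child a l f A K t.
pose F' x := M^-1 * F x.
have mF' : measurable_fun setT F' by exact: (measurable_funM (measurable_cst _) mF).
have F'0 x : 0 <= F' x by rewrite mulr_ge0// invr_ge0 ltW.
have mcell Q : measurable (cell Q) by exact: measurable_dcell.
have csub Q P : child Q P -> cell P `<=` cell Q by exact: stop_child_sub.
have cuniq Q P P' x : child Q P -> child Q P' -> cell P x -> cell P' x -> P = P'.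
  exact: stop_child_uniq.
pose b Q := Phi (A (dcube a l Q)).
have b0 Q : 0 <= b Q by exact: (Phi_ge0 hPhi).
have bvH i Q x : desc child q0 i Q -> cell Q x -> b Q * v x <= H x.
  move=> _ Qx; rewrite ler_wpM2r//; apply: (Phi_homo hPhi) => //; apply: Ag.
  exact: dcell_sub_dcube.
have hlayer Q : (mu (layer cell child Q 1) <= lam%:E * mu (cell Q))%E.
  exact: leb_layer1.
have wv i Q j : desc child q0 i Q ->
   (\int[mu]_(x in layer cell child Q j) (w x)%:E <=
   (C * r ^+ j)%:E * \int[mu]_(x in cell Q `\` layer cell child Q (j + j0)) (v x)%:E)%E.
  move=> _; have [[x Qx]|nQ] := pselect (cell Q !=set0); last first.
    rewrite (_ : layer cell child Q j = set0).
      rewrite integral_set0 mule_ge0 ?lee_fin ?mulr_ge0 ?exprn_ge0 ?(ltW C0)//.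
      by apply: integral_ge0 => x _; rewrite lee_fin.
    by apply/seteqP; split => // x /(layer_sub csub) Qx; apply: nQ; exists x.
  rewrite [cell Q](dcell_hcube l0 Qx); apply: HC.
  - exact: grid_side_gt0.
  - by move=> k; apply: layer_measurable.
  - by move=> k; rewrite -(dcell_hcube l0 Qx); exact: layer_sub.
  - by move=> i' k ik; exact: layer_le.
  - move=> k; rewrite -(dcell_hcube l0 Qx).
    by apply: (layer_measure mcell csub cuniq) => //; exact: ltW.
have Fw : \forall x \ae mu, cell q0 x -> exists k, exists q : nat -> nat,
    [/\ q 0%N = q0, cell (q k) x, forall i, (i < k)%N -> child (q i) (q i.+1) &
    F' x <= (\sum_(i < k.+1) c ^+ (k - i) * b (q i)) * w x].
  have q0n : dcell a l q0 !=set0 by exists a.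
  have := stopping_representation l0 mf K0 hs ht N0 hN A0 Ale hosc q0n.
  apply: filterS => x /[apply] -[k [q [q00 qk qc fx]]]; exists k, q; split => //.
  rewrite /F' /F mulrA ler_wpM2r// ler_pdivrMl// /M -mulrA.
  have sum0 : 0 <= \sum_(i < k.+1) A (dcube a l (q i)) by exact: sumr_ge0.
  have -> : m = med a l f t q0 by rewrite /m /med cubeE.
  apply: (@le_trans _ _ (Phi (2 ^+ kap * \sum_(i < k.+1) A (dcube a l (q i))))).
    apply: (Phi_homo hPhi) => //; apply: le_trans fx _.
    by rewrite ler_wpM2r.
  apply: le_trans (Phi_scale hPhi _ sum0) _.
  rewrite ler_wpM2l ?exprn_ge0//.
  exact: (Phi_sum hPhi k (fun i => A0 (dcube a l (q i)))).
have HS k : \sum_(0 <= j < k) (c * r) ^+ j * (j + j0)%:R <= S.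
  exact: arith_geometric_sum_le.
have main := sparse_integral_le mcell csub cuniq mv v0 b0 H0 bvH mw w0 mF' F'0
  c_ge0 r0 (ltW C0) wv Fw HS.
have mQ : measurable (cube a l) by apply: measurable_cube; exact: ltW.
have mh := measurable_hcube a l.
have mFQ : measurable_fun (cube a l) (EFin \o F) := measurable_EFin_sub mF mQ.
have mF'h : measurable_fun (hcube a l) (EFin \o F') := measurable_EFin_sub mF' mh.
have F0E x : cube a l x -> (0 <= (F x)%:E)%E by rewrite lee_fin.
have F'0E x : hcube a l x -> (0 <= (F' x)%:E)%E by rewrite lee_fin.
have FE := ge0_integral_null_diff mh mQ (@hcube_sub R n a l)
  (leb_cubeD_hcube a l0) mFQ F0E.
rewrite -[leLHS]FE.
move: main; rewrite /cell q0E => main.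
have IH : (\int[mu]_(x in hcube a l) (H x)%:E <= \int[mu]_(x in cube a l) (H x)%:E)%E.
  rewrite integral_mkcond [leRHS]integral_mkcond; apply: ge0_le_lower_integral => x _.
    by apply: erestrict_ge0 => y _; rewrite lee_fin.
  rewrite !patchE; case: ifPn => [/set_mem /hcube_sub xQ|_]; first by rewrite mem_set.
  by case: ifP; rewrite ?lee_fin.
have I0 : (0 <= \int[mu]_(x in cube a l) (H x)%:E)%E.
  by apply: integral_ge0 => x _; rewrite lee_fin.
have -> : (\int[mu]_(x in hcube a l) (EFin \o F) x =
    M%:E * \int[mu]_(x in hcube a l) (F' x)%:E)%E.
  rewrite -(ge0_integralZl_EFin mu mh F'0E mF'h (ltW M0)).
  by apply: eq_integral => x _; rewrite -EFinM /F' mulVKf// gt_eqF.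
apply: (@le_trans _ _ ((M * (C * S))%:E * \int[mu]_(x in cube a l) (H x)%:E)%E).
  rewrite [in leRHS]EFinM -[leRHS]muleA lee_wpmul2l ?lee_fin ?(ltW M0)//.
  apply: le_trans main _; rewrite lee_wpmul2l// lee_fin mulr_ge0// ltW//.
by rewrite lee_wpmul2r// lee_fin lerDl.
Qed.

End Local.

(** * From cubes to the whole space *)

Section Global.
Variables (R : realType) (n : nat).
Local Notation mu := (leb R n).

Definition centered_cube k : set (Rn R n) :=
  cube ([tuple - k.+1%:R | i < n] : Rn R n) (2 * k.+1%:R).

Lemma centered_cubeP k x :
  centered_cube k x <-> forall i, `|Rn_coord x i| <= k.+1%:R.
Proof.
have e : - k.+1%:R + 2 * k.+1%:R = k.+1%:R :> R by ring.
split=> H i; have := H i; rewrite ler_norml /Rn_coord tnth_mktuple e //.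
Qed.

Lemma is_cube_centered k : is_cube (centered_cube k).
Proof. by exists [tuple - k.+1%:R | i < n], (2 * k.+1%:R); split. Qed.

Lemma near_centered_cube x : \forall k \near \oo, centered_cube k x.
Proof.
pose B := \sum_(i < n) `|Rn_coord x i|.
near=> k; apply/centered_cubeP => i.
apply: (@le_trans _ _ B); first by rewrite /B (bigD1 i)//= lerDl sumr_ge0.
apply: (@le_trans _ _ k%:R); last by rewrite ler_nat.
by near: k; exact: nbhs_infty_ger.
Unshelve. all: by end_near. Qed.

Lemma centered_cubes_cvg : centered_cube k @[k --> \oo] --> cubes_to_Rn R n.
Proof.
move=> P [Q1 [a [l [l0 ->]]] HP].
pose b : Rn R n := [tuple Rn_coord a i + l | i < n].
have bE i : Rn_coord b i = Rn_coord a i + l by rewrite /Rn_coord tnth_mktuple.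
suff : \forall k \near \oo, P (centered_cube k) by [].
have := near_centered_cube b; apply: filterS2 (near_centered_cube a).
move=> k /centered_cubeP ak /centered_cubeP bk.
apply: HP; first exact: is_cube_centered.
move=> x xa; apply/centered_cubeP => i; have := bk i; rewrite bE.
have /andP[x1 x2] := xa i; have := ak i; rewrite !ler_norml => /andP[? ?] /andP[? ?].
by apply/andP; split; lra.
Qed.

Lemma condition_C_cvg (Phi : R -> R) (c0 : R) (y : nat -> R) (y0 : R) :
  condition_C Phi c0 -> (forall k, 0 <= y k) -> 0 <= y0 ->
  y k @[k --> \oo] --> y0 -> Phi (y k) @[k --> \oo] --> Phi y0.
Proof.
move=> [cont _ _ _] yk y00 cv.
have Ay0 : `[0, +oo[%classic y0 by rewrite /= in_itv /= y00.
have cvy : y k @[k --> \oo] --> within `[0, +oo[%classic (nbhs y0).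
  move=> P /= HP.
  have : \forall k \near \oo, `[0, +oo[%classic (y k) -> P (y k) := cv _ HP.
  by apply: filterS => k; apply; rewrite /= in_itv /= yk.
exact: cvg_comp ((subspace_cvgP _ Ay0).2 cvy) (cont y0).
Qed.

(** Fatou's lemma along an exhausting sequence of cubes. *)
Lemma integral_le_of_cubes (Phi : R -> R) (c0 c : R) (w v f g : Rn R n -> R)
    (m : set (Rn R n) -> R) :
  condition_C Phi c0 -> measurable_fun setT w -> (forall x, 0 <= w x) ->
  (forall x, 0 <= v x) -> measurable_fun setT f -> (forall x, 0 <= g x) -> 0 <= c ->
  (forall Q, is_cube Q ->
    (\int[mu]_(x in Q) (Phi `|f x - m Q| * w x)%:E
     <= c%:E * \int[mu]_(x in Q) (Phi (g x) * v x)%:E)%E) ->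
  m Q @[Q --> cubes_to_Rn R n] --> (0 : R) ->
  (\int[mu]_x (Phi `|f x| * w x)%:E <= c%:E * \int[mu]_x (Phi (g x) * v x)%:E)%E.
Proof.
move=> hPhi mw w0 v0 mf g0 c_ge0 local m0.
have mcv : m (centered_cube k) @[k --> \oo] --> (0 : R).
  exact: cvg_comp centered_cubes_cvg m0.
pose Fk k x := Phi `|f x - m (centered_cube k)| * w x.
have Fk0 k x : 0 <= Fk k x by rewrite mulr_ge0// (Phi_ge0 hPhi).
have mFk k : measurable_fun setT (Fk k).
  apply: (measurable_funM _ mw).
  exact: (measurable_Phi_comp hPhi (measurable_dist _ mf) (fun x => normr_ge0 _)).
pose G k := ((EFin \o Fk k) \_ (centered_cube k)).
have G0 k x : (0 <= G k x)%E.
  by apply: erestrict_ge0 => y _; rewrite lee_fin; exact: Fk0.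
have mQ k : measurable (centered_cube k) := is_cube_measurable (is_cube_centered k).
have mG k : measurable_fun setT (G k).
  exact: (measurable_restrictT _ (mQ k)).1 (measurable_EFin_sub (mFk k) (mQ k)).
have Glim x : limn_einf (G^~ x) = (Phi `|f x| * w x)%:E.
  apply: (cvg_limn_einf_sup _).1.
  have cvF : Fk k x @[k --> \oo] --> Phi `|f x| * w x.
    apply: cvgMl; apply: (condition_C_cvg hPhi) => //.
    have : (f x - m (centered_cube k)) @[k --> \oo] --> f x - 0.
      exact: cvgB (cvg_cst _) mcv.
    by rewrite subr0 => /cvg_norm.
  have : (EFin \o (fun k => Fk k x)) k @[k --> \oo] --> (Phi `|f x| * w x)%:E.
    by apply: cvg_EFin => //; near=> k.
  apply: cvg_trans; apply: near_eq_cvg.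
  have := near_centered_cube x; apply: filterS => k Qx /=.
  by rewrite /G patchE mem_set.
under eq_integral do rewrite -Glim.
apply: le_trans (fatou mu measurableT mG (fun k x _ => G0 k x)) _.
rewrite limn_einf_lim; apply: lime_le; first exact: is_cvg_einfs.
near=> k; apply: (@le_trans _ _ (\int[mu]_x G k x)%E).
  by apply: ereal_inf_lbound; exists k => /=.
rewrite /G -integral_mkcond; apply: le_trans (local _ (is_cube_centered k)) _.
rewrite lee_wpmul2l ?lee_fin//.
rewrite integral_mkcond; apply: ge0_le_lower_integral => x _.
  by apply: erestrict_ge0 => y _; rewrite lee_fin mulr_ge0// (Phi_ge0 hPhi).
by rewrite patchE; case: ifP => _ //; rewrite lee_fin mulr_ge0// (Phi_ge0 hPhi).
Unshelve. all: by end_near. Qed.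

End Global.

Theorem theorem5p1 (R : realType) (n : nat) (n_gt0 : (0 < n)%N)
  (Phi : R -> R) (c0 : R) (hPhi : condition_C Phi c0)
  (w v : Rn R n -> R) (hw : weight w) (hv : weight v)
  (beta : R) (hF : condition_F w v beta)
  (s t : R) (hs : 0 < s <= 1 / 2) (ht : 1 / 2 < t < 1 - s)
  (hst : c0 * (s / (1 - t)) `^ beta < 1)
  (X : topologicalLmodType R) (T : {linear X -> (Rn R n -> R^o)})
  (mT : forall f, measurable_fun setT (T f : Rn R n -> R))
  (MT : X -> Rn R n -> R) (MT_ge0 : forall f x, 0 <= MT f x)
  (S : set X) (hsplit : splitting_property T MT s S) :
  exists2 c : R, 0 < c &
    (forall (Q0 : set (Rn R n)) (f : X), is_cube Q0 -> S f ->
       (\int[leb R n]_(x in Q0) (Phi `|T f x - median (T f) t Q0| * w x)%:E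
        <= c%:E * \int[leb R n]_(x in Q0) (Phi (MT f x) * v x)%:E)%E) /\
    (forall f : X, S f ->
       median (T f) t Q0 @[Q0 --> cubes_to_Rn R n] --> (0 : R) ->
       (\int[leb R n]_x (Phi `|T f x| * w x)%:E
        <= c%:E * \int[leb R n]_x (Phi (MT f x) * v x)%:E)%E).
Proof.
have /andP[s0 _] := hs.
have [K K0 osc] := splitting_oscillation mT hsplit.
have [c c0' local] := median_integral_le n_gt0 hPhi hw hv hF s0 ht hst K0.
have [mw w0 _] := hw; have [_ v0 _] := hv.
have part1 (Q0 : set (Rn R n)) (f : X) : is_cube Q0 -> S f ->
    (\int[leb R n]_(x in Q0) (Phi `|T f x - median (T f) t Q0| * w x)%:E
      <= c%:E * \int[leb R n]_(x in Q0) (Phi (MT f x) * v x)%:E)%E.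
  move=> [a [l [l0 ->]]] Sf; apply: (local a l (T f) (MT f) (inf_on MT f)) => //.
  - exact: inf_on_ge0.
  - by move=> Q x; exact: inf_on_le.
  - exact: inf_on_anti.
  - exact: osc.
exists c => //; split => // f Sf med0.
apply: (integral_le_of_cubes hPhi mw w0 v0 (mT f) (MT_ge0 f) (ltW c0') _ med0).
by move=> Q cQ; exact: part1.
Qed.
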